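(* There is a family $\mathcal{F}$ of cardinality $\mathfrak{c}$ consisting of pairwise non-homeomorphic endpoint rigid smooth fans. Further, for each of the following three spaces $E$, the family $\mathcal{F}$ can be chosen so that $E(X)$ is homeomorphic to $E$ for every $X \in \mathcal{F}$: $E$ the natural numbers (discrete); $E$ the space of irrational numbers; $E$ the product of the Cantor set with the (discrete) natural numbers.
   Context: $\mathfrak{c}$ is the cardinality of the continuum. A continuum is a compact connected metric space; it is non-degenerate if it has more than one point. The Cantor fan $F_C$ is the cone over the Cantor set $C$. A smooth fan is a non-degenerate continuum $X$ homeomorphic to a subcontinuum of $F_C$; it is always assumed that the embedding is such that the image contains the cone point and the cone point has order at least $2$ in $X$. Here a point $x$ has order at least $n$ in $X$ if there are $n$ arcs in $X$ having $x$ as one endpoint which are otherwise pairwise disjoint. An endpoint of $X$ is a point of order exactly $1$; $E(X)$ denotes the set (subspace) of endpoints of $X$. A smooth fan $X$ is endpoint rigid if for each homeomorphism $h \colon X \to X$ (onto $X$), $h(x) = x$ for all $x \in E(X)$. *)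

(* Defs.v *)
From HB Require Import structures.
From mathcomp Require Import all_boot all_order all_algebra.
From mathcomp Require Import all_classical all_reals all_analysis.

Set Implicit Arguments.
Unset Strict Implicit.
Unset Printing Implicit Defensive.

Import Order.TTheory GRing.Theory Num.Theory.
Import numFieldNormedType.Exports.

Local Open Scope classical_set_scope.
Local Open Scope ring_scope.
Local Open Scope quotient_scope.

(* Subsets regarded as spaces in their own right are the types [set_type A],
   which the library equips with the subspace topology. *)

Definition homeomorphism (S T : topologicalType) (f : S -> T) : Prop :=
  exists g : T -> S,
    [/\ cancel f g, cancel g f, continuous f & continuous g].

Definition homeomorphic (S T : topologicalType) : Prop :=
  exists f : S -> T, homeomorphism f.

Section UnitInterval.
Variable R : realType.

Definition unit_interval : topologicalType :=
  set_type (`[0, 1]%classic : set R).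

Lemma unit_interval0_subproof : (0 : R) \in (`[0, 1]%classic : set R).
Proof. by apply/mem_set; rewrite /= in_itv /= lexx ler01. Qed.

Lemma unit_interval1_subproof : (1 : R) \in (`[0, 1]%classic : set R).
Proof. by apply/mem_set; rewrite /= in_itv /= lexx ler01. Qed.

Definition unit_interval0 : unit_interval := exist _ 0 unit_interval0_subproof.
Definition unit_interval1 : unit_interval := exist _ 1 unit_interval1_subproof.

End UnitInterval.

Section Cone.
Variables (R : realType) (T : topologicalType).

Definition cone_rel (p q : T * unit_interval R) : bool :=
  (p == q) || ((p.2 == unit_interval1 R) && (q.2 == unit_interval1 R)).

Lemma cone_rel_refl : reflexive cone_rel.
Proof. by move=> p; rewrite /cone_rel eqxx. Qed.

Lemma cone_rel_sym : symmetric cone_rel.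
Proof. by move=> p q; rewrite /cone_rel eq_sym andbC. Qed.

Lemma cone_rel_trans : transitive cone_rel.
Proof.
move=> q p r /orP[/eqP -> //|/andP[p1 q1]] /orP[/eqP <-|/andP[_ r1]].
  by rewrite /cone_rel p1 q1 orbT.
by rewrite /cone_rel p1 r1 orbT.
Qed.

Canonical cone_equiv := EquivRel cone_rel cone_rel_refl cone_rel_sym
  cone_rel_trans.

(* [T * [0, 1]] with [T * {1}] collapsed to a point *)
Definition cone : topologicalType := quotient_topology {eq_quot cone_equiv}.

End Cone.

Definition cantor_fan (R : realType) : topologicalType := cone R cantor_space.

Definition cone_point (R : realType) : cantor_fan R :=
  \pi_(quotient_topology {eq_quot (cone_equiv R cantor_space)})
    (point : cantor_space, unit_interval1 R).

Section Fans.
Variable R : realType.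

Section Order.
Variable X : topologicalType.

Definition arc_with_endpoint (A : set X) (x : X) : Prop :=
  exists2 f : unit_interval R -> set_type A,
    homeomorphism f & set_val (f (unit_interval0 R)) = x.

Definition order_at_least (n : nat) (x : X) : Prop :=
  exists2 A : 'I_n -> set X,
    forall i, arc_with_endpoint (A i) x &
    forall i j, i != j -> A i `&` A j = [set x].

Definition endpoints : set X :=
  [set x | order_at_least 1 x /\ ~ order_at_least 2 x].

End Order.

Definition nondegenerate_continuum (X : metricType R) : Prop :=
  [/\ compact [set: X], connected [set: X] & exists x y : X, x <> y].

Definition smooth_fan (X : metricType R) : Prop :=
  nondegenerate_continuum X /\
  exists K : set (cantor_fan R),
    [/\ compact K, connected K &
      exists2 f : X -> set_type K, homeomorphism f &
        exists2 x : X, set_val (f x) = cone_point R & order_at_least 2 x].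

Definition endpoint_rigid (X : metricType R) : Prop :=
  forall h : X -> X, homeomorphism h -> forall x, endpoints x -> h x = x.

(* The family is indexed without repetition by the real line, hence has
   cardinality exactly that of the continuum. *)
Definition rigid_fan_family (F : R -> metricType R) : Prop :=
  (forall i, smooth_fan (F i) /\ endpoint_rigid (F i)) /\
  (forall i j, i <> j -> ~ homeomorphic (F i) (F j)).

End Fans.

Arguments endpoints R X : clear implicits.

(* Main.v *)
(* A leg of the fan over [x] in the Cantor set runs from the apex to a tip at
   height [f x], for an upper semicontinuous [f].  Call a point of the closure
   of the set of tips a mark if it is neither a tip nor the apex.  Homeomorphisms
   fix the apex, which is the only point separating all endpoints from one
   another, hence they preserve the number of marks on a leg.  So if some legs
   with dense tips carry pairwise different positive numbers of marks and the
   other legs carry none, the fan is endpoint rigid; and these numbers may be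
   chosen from [{2c+1, 2c+2}] for each [c], which encodes a real as a subset of
   the naturals and yields continuum many fans.

   The function [f] is the limit of heights computed by reading [x] bit by bit:
   the height drops at a nonzero bit in a "lossy" position, to one of finitely
   many values determined by the preceding bits, each of which recurs for
   infinitely many positions.  These values are the marks of the leg over the
   preceding bits followed by zeros.  If every position is lossy and the drop
   tends to [0], the tips are isolated and countable; if only odd positions are
   lossy, the even bits contribute a Cantor set factor; if moreover the drop
   itself tends to zero, all heights are positive and the tips form a space with
   the same tree of clopen pieces as the irrational numbers. *)
Require Import Defs.
From HB Require Import structures.
From mathcomp Require Import all_boot all_order all_algebra.
From mathcomp Require Import all_classical all_reals all_analysis.
From mathcomp Require Import ring lra zify.
Import numFieldNormedType.Exports.

Set Implicit Arguments.
Unset Strict Implicit.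
Unset Printing Implicit Defensive.

Import Order.TTheory GRing.Theory Num.Theory.

Local Open Scope classical_set_scope.
Local Open Scope ring_scope.
Local Open Scope card_scope.

(** * Topological invariants of fans *)

(** The counts of marks must be exact, so unintended marks are the main danger. Over a fixed word
    the drop index runs through the residues modulo the prescribed count, and different residues
    give different heights; this produces the wanted marks. From a state whose last nonzero bit is
    at [L - 1], all later heights stay within [2^-L] of the present height or fall below [2^-L];
    this excludes all others. The fan is realised in the plane by segments from the origin whose
    slopes encode points of the Cantor set. Its metric is then explicit, and it is compared with the
    cone by a single continuous bijection from a compact space. Heights are not continuous in the
    leg, so tips are close when the bits agree for long and, in addition, the heights are close;
    every description of a space of tips is phrased in these two terms. At least three legs are
    required, because with two the fan is an arc and no interior point stands out as the apex. *)

Definition to_set_type (T : Type) (A : set T) (x : T) (Ax : A x) : set_type A :=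
  exist _ x (mem_set Ax).

Section GeneralTopology.

Lemma set_val_continuous (T : topologicalType) (A : set T) :
  continuous (@set_val T A).
Proof. exact: initial_continuous. Qed.

Lemma continuous_set_val (S T : topologicalType) (A : set T)
  (g : S -> set_type A) : continuous (set_val \o g) -> continuous g.
Proof. exact: continuous_comp_initial. Qed.

Lemma compact_hausdorff_inverse (S T : topologicalType) (f : S -> T)
  (g : T -> S) : compact [set: S] -> hausdorff_space T ->
  cancel f g -> cancel g f -> continuous f -> continuous g.
Proof.
move=> cS hT fK gK cf; apply/continuous_closedP => C cC.
have -> : g @^-1` C = f @` C.
  apply/seteqP; split => [y Cy|_ [x Cx <-]]; last by rewrite /= fK.
  by exists (g y).
apply: compact_closed => //; apply: continuous_compact.
  exact: continuous_subspaceT.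
exact: (subclosed_compact cC cS).
Qed.

Lemma homeomorphism_comp (S T U : topologicalType) (f : S -> T) (g : T -> U) :
  homeomorphism f -> homeomorphism g -> homeomorphism (g \o f).
Proof.
move=> [f' [fK f'K cf cf']] [g' [gK g'K cg cg']]; exists (f' \o g').
split; [exact: can_comp|exact: can_comp| |].
- by move=> x; apply: continuous_comp; [exact: cf|exact: cg].
- by move=> x; apply: continuous_comp; [exact: cg'|exact: cf'].
Qed.

Lemma homeomorphism_inv (S T : topologicalType) (f : S -> T) :
  homeomorphism f ->
  exists2 g, homeomorphism g & cancel f g /\ cancel g f.
Proof. by move=> [g [fK gK cf cg]]; exists g => //; exists f. Qed.

Lemma homeomorphism_image (S T : topologicalType) (f : S -> T) (A : set S) :
  homeomorphism f ->
  exists2 g : set_type A -> set_type (f @` A), homeomorphism g &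
    forall a, set_val (g a) = f (set_val a).
Proof.
move=> [f' [fK f'K cf cf']].
have gP (a : A) : (f @` A) (f (set_val a)).
  by exists (set_val a) => //; exact: set_valP.
have hP (b : f @` A) : A (f' (set_val b)).
  by have [a Aa <-] : (f @` A) (set_val b) := set_valP b; rewrite fK.
exists (fun a => to_set_type (gP a)) => //.
exists (fun b => to_set_type (hP b)); split.
- by move=> a; apply: val_inj; exact: fK.
- by move=> a; apply: val_inj; exact: f'K.
- apply: continuous_set_val => x; apply: (@continuous_comp _ _ _ set_val f).
    exact: set_val_continuous.
  exact: cf.
- apply: continuous_set_val => x; apply: (@continuous_comp _ _ _ set_val f').
    exact: set_val_continuous.
  exact: cf'.
Qed.

(** The trace of [U] on [A] is clopen in [A], its complement there being the trace of [V];
    disjointness is needed only inside [A]. *)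
Lemma connected_open_split (T : topologicalType) (A U V : set T) :
  connected A -> open U -> open V -> A `<=` U `|` V ->
  A `&` U `&` V = set0 -> A `&` U !=set0 -> A `<=` U.
Proof.
move=> cA oU oV AUV UV0 AU.
suff <- : A `&` U = A by move=> x [].
apply: (cA) => //; first by exists U.
exists (~` V); first exact: open_closedC.
apply/seteqP; split => x [Ax].
  by move=> Ux; split => // Vx; have : (A `&` U `&` V) x by []; rewrite UV0.
by move=> nVx; split => //; have [] := AUV _ Ax.
Qed.

(** Connected sets are used in place of arcs, so that transport along a continuous injection is just
    passing to the image. *)
Definition joined_off (X : topologicalType) (v x y : X) : Prop :=
  exists C : set X, [/\ connected C, C x, C y & ~ C v].

Lemma joined_off_image (X Y : topologicalType) (h : X -> Y) (v x y : X) :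
  continuous h -> injective h -> joined_off v x y ->
  joined_off (h v) (h x) (h y).
Proof.
move=> ch ih [C [cC Cx Cy nCv]]; exists (h @` C); split.
- by apply: connected_continuous_connected => //; exact: continuous_subspaceT.
- by exists x.
- by exists y.
- by move=> [z Cz /ih zv]; apply: nCv; rewrite -zv.
Qed.

End GeneralTopology.

(** * Endpoints and marks under homeomorphisms *)

Section Invariance.
Variable R : realType.

Lemma order_at_least_homeo (X Y : topologicalType) (h : X -> Y) n x :
  homeomorphism h -> order_at_least R n x -> order_at_least R n (h x).
Proof.
move=> hh [A arcA disjA]; have [h' [hK h'K ch ch']] := hh.
exists (fun i => h @` A i) => [i|i j ij].
  have [f hf f0] := arcA i; have [g hg gE] := homeomorphism_image (A i) hh.
  by exists (g \o f); [exact: homeomorphism_comp|rewrite /= gE f0].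
rewrite -image_set1 -(disjA i j ij); apply/seteqP; split.
  move=> y [[a Aa <-] [b Bb /(can_inj hK) ba]].
  by exists a => //; split => //; rewrite -ba.
by move=> _ [a [Aa Ba] <-]; split; exists a.
Qed.

Lemma endpoints_homeo (X Y : topologicalType) (h : X -> Y) x :
  homeomorphism h -> endpoints R Y (h x) <-> endpoints R X x.
Proof.
move=> hh; have [g hg [hK gK]] := homeomorphism_inv hh.
have ordE n : order_at_least R n (h x) <-> order_at_least R n x.
  split; last exact: order_at_least_homeo.
  by rewrite -{2}(hK x); exact: order_at_least_homeo.
by rewrite /endpoints /=; split => -[/ordE ? n2]; split => // /ordE.
Qed.

(* A vertex of a fan with at least three legs, in terms invariant under
   homeomorphisms. *)
Definition separates_endpoints (X : topologicalType) (v : X) : Prop :=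
  forall e e', endpoints R X e -> endpoints R X e' -> e <> e' ->
    ~ joined_off v e e'.

Lemma separates_endpoints_homeo (X Y : topologicalType) (h : X -> Y) v :
  homeomorphism h -> separates_endpoints v -> separates_endpoints (h v).
Proof.
move=> hh sv e e' Ee Ee' ee' jee'.
have [g hg [hK gK]] := homeomorphism_inv hh.
have [_ [_ _ cg _]] := hg.
apply: (sv (g e) (g e')).
- by apply/(endpoints_homeo _ hg).
- by apply/(endpoints_homeo _ hg).
- by move/(can_inj gK).
- by rewrite -(hK v); apply: joined_off_image => //; exact: can_inj gK.
Qed.

(** The leg of [e] is described as the set of points joined to [e] away from [v], so that no
    coordinates enter. *)
Definition marks (X : topologicalType) (v e : X) : set X :=
  [set z | [/\ closure (endpoints R X) z, ~ endpoints R X z, z <> v &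
            joined_off v z e]].

Lemma marks_homeo_sub (X Y : topologicalType) (h : X -> Y) v e z :
  homeomorphism h -> marks v e z -> marks (h v) (h e) (h z).
Proof.
move=> hh [cz nz zv jz]; have [g [hK gK ch cg]] := hh; split.
- move=> B /ch /cz [y [Ey By]]; exists (h y); split => //.
  exact/endpoints_homeo.
- by move/(endpoints_homeo _ hh).
- by move/(can_inj hK).
- by apply: joined_off_image => //; exact: can_inj hK.
Qed.

Lemma marks_homeo (X Y : topologicalType) (h : X -> Y) v e :
  homeomorphism h -> h @` marks v e = marks (h v) (h e).
Proof.
move=> hh; have [g hg [hK gK]] := homeomorphism_inv hh.
apply/seteqP; split => [_ [z mz <-]|z mz]; first exact: marks_homeo_sub.
by exists (g z) => //; rewrite -(hK v) -(hK e); apply: marks_homeo_sub.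
Qed.

Lemma card_marks_homeo (X Y : topologicalType) (h : X -> Y) v e n :
  homeomorphism h -> marks (h v) (h e) #= `I_n <-> marks v e #= `I_n.
Proof.
move=> hh; rewrite -(marks_homeo v e hh).
have [g hg [hK gK]] := homeomorphism_inv hh.
have hE : h @` marks v e #= marks v e.
  by apply: inj_card_eq => x y _ _ /(can_inj hK).
split => H; first by apply: card_eq_trans H; rewrite card_eq_sym.
exact: card_eq_trans hE H.
Qed.

End Invariance.

(** * Trees of clopen pieces and the spaces they determine *)

Section Schemes.

Fixpoint walk (N : Type) (root : N) (child : N -> nat -> N) (al : nat -> nat)
    (k : nat) : N :=
  if k is k'.+1 then child (walk root child al k') (al k') else root.

(** A complete scheme with countably infinite branching, which characterises the Baire space. The
    conditions concern only nodes reached by a walk, so nodes may be raw data. The third clause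
    makes the pieces along an address a neighbourhood base; the fourth is completeness and also
    makes the pieces nonempty. *)
Definition scheme (Y : topologicalType) (N : Type) (root : N)
    (child : N -> nat -> N) (P : N -> set Y) : Prop :=
  [/\ P root = [set: Y],
      forall al k, let v := walk root child al k in
        [/\ open (P v), P v `<=` \bigcup_n P (child v n),
            forall n, P (child v n) `<=` P v &
            forall m n x, P (child v m) x -> P (child v n) x -> m = n],
      forall al x U, (forall k, P (walk root child al k) x) -> nbhs x U ->
        exists k, P (walk root child al k) `<=` U &
      forall al, exists x, forall k, P (walk root child al k) x].

Variables (Y Z : topologicalType) (N M : Type) (rN : N) (rM : M).
Variables (cN : N -> nat -> N) (cM : M -> nat -> M).
Variables (P : N -> set Y) (Q : M -> set Z).

Lemma scheme_address : scheme rN cN P ->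
  forall x, exists al, forall k, P (walk rN cN al k) x.
Proof.
move=> [P0 PS _ _] x.
pose a v := get [set n | P (cN v n) x].
(* The nodes are built first and the address is read off them, since each choice depends on the node
   already reached. *)
pose u := fix u k := if k is k'.+1 then cN (u k') (a (u k')) else rN.
have wu k : walk rN cN (a \o u) k = u k by elim: k => //= k ->.
exists (a \o u); elim => [|k]; first by rewrite /= P0.
move=> Pk; have [_ sub _ _] := PS (a \o u) k.
have [n _ Pn] := sub _ Pk.
rewrite wu in Pn; rewrite wu /=.
by have /getPex : exists n, [set n | P (cN (u k) n) x] n by exists n.
Qed.

Lemma scheme_address_uniq : scheme rN cN P ->
  forall x al be k, P (walk rN cN al k) x -> P (walk rN cN be k) x ->
  walk rN cN al k = walk rN cN be k /\ forall i, (i < k)%N -> al i = be i.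
Proof.
move=> [_ PS _ _] x al be; elim => [|k IH] //= Pal Pbe.
have [_ _ sal dal] := PS al k; have [_ _ sbe _] := PS be k.
have [e ab] := IH (sal _ _ Pal) (sbe _ _ Pbe).
have abk : al k = be k by apply: (dal _ _ x) => //; rewrite e.
by split=> [|i]; rewrite ?e ?abk // ltnS leq_eqVlt => /orP[/eqP ->|/ab].
Qed.

Lemma walk_eq al be k : (forall i, (i < k)%N -> al i = be i) ->
  walk rM cM al k = walk rM cM be k.
Proof.
elim: k => //= k IH ab; rewrite IH ?ab // => i ik.
by apply: ab; exact: ltnW.
Qed.

Lemma scheme_limit_uniq : hausdorff_space Y -> scheme rN cN P ->
  forall al x y, (forall k, P (walk rN cN al k) x) ->
    (forall k, P (walk rN cN al k) y) -> x = y.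
Proof.
move=> hY [_ _ sh _] al x y Px Py; apply: hY => A B xA yB.
have [k kA] := sh _ _ _ Px xA.
by exists y; split; [exact/kA/Py|exact: nbhs_singleton].
Qed.

End Schemes.

(** Lying in the piece of [P] at depth [k] fixes the first [k] entries of the address, and these
    determine the piece of [Q] containing the image. *)
Lemma scheme_transport (Y Z : topologicalType) (N M : Type) (rN : N) (rM : M)
    (cN : N -> nat -> N) (cM : M -> nat -> M) (P : N -> set Y) (Q : M -> set Z)
    (f : Y -> Z) : scheme rN cN P -> scheme rM cM Q ->
  (forall x al, (forall k, P (walk rN cN al k) x) ->
     forall k, Q (walk rM cM al k) (f x)) ->
  continuous f.
Proof.
move=> sP sQ fPQ x U fxU.
have [al xal] := scheme_address sP x.
have [_ _ sh _] := sQ; have [k kU] := sh _ _ _ (fPQ _ _ xal) fxU.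
have [_ PS _ _] := sP; have [Po _ _ _] := PS al k.
apply: filterS (open_nbhs_nbhs (conj Po (xal k))) => y Py.
have [be ybe] := scheme_address sP y.
have [_ abk] := scheme_address_uniq sP Py (ybe k).
by apply: kU; rewrite (walk_eq _ _ abk); exact: fPQ.
Qed.

(** Points with the same address are matched: each point has exactly one address and each address
    names exactly one point. *)
Lemma scheme_homeomorphic (Y Z : topologicalType) (N M : Type) (rN : N) (rM : M)
    (cN : N -> nat -> N) (cM : M -> nat -> M) (P : N -> set Y) (Q : M -> set Z) :
  hausdorff_space Y -> hausdorff_space Z ->
  scheme rN cN P -> scheme rM cM Q -> homeomorphic Y Z.
Proof.
move=> hY hZ sP sQ.
have fE x : exists z, exists2 al, forall k, P (walk rN cN al k) x
    & forall k, Q (walk rM cM al k) z.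
  have [al xal] := scheme_address sP x; have [_ _ _ /(_ al)[z zal]] := sQ.
  by exists z, al.
have gE z : exists x, exists2 al, forall k, Q (walk rM cM al k) z
    & forall k, P (walk rN cN al k) x.
  have [al xal] := scheme_address sQ z; have [_ _ _ /(_ al)[x zal]] := sP.
  by exists x, al.
have [f fP] := choice fE; have [g gP] := choice gE.
have fPQ x al : (forall k, P (walk rN cN al k) x) ->
    forall k, Q (walk rM cM al k) (f x).
  move=> xal k; have [be xbe fbe] := fP x.
  by have [_ /(@walk_eq _ rM cM) ->] := scheme_address_uniq sP (xal k) (xbe k).
have gPQ x al : (forall k, Q (walk rM cM al k) x) ->
    forall k, P (walk rN cN al k) (g x).
  move=> xal k; have [be xbe fbe] := gP x.
  by have [_ /(@walk_eq _ rN cN) ->] := scheme_address_uniq sQ (xal k) (xbe k).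
exists f, g; split.
- move=> x; have [al xal] := scheme_address sP x.
  by apply: (scheme_limit_uniq hY sP _ xal); exact/gPQ/fPQ.
- move=> x; have [al xal] := scheme_address sQ x.
  by apply: (scheme_limit_uniq hZ sQ _ xal); exact/fPQ/gPQ.
- exact: scheme_transport fPQ.
- exact: scheme_transport gPQ.
Qed.

(** * Fans over the Cantor set *)

Definition bits := nat -> bool.

Definition agree (n : nat) (x y : bits) : Prop :=
  forall i, (i < n)%N -> x i = y i.

Lemma agree_sym n x y : agree n x y -> agree n y x.
Proof. by move=> xy i /xy. Qed.

Lemma agree_trans n x y z : agree n x y -> agree n y z -> agree n x z.
Proof. by move=> xy yz i im; rewrite xy ?yz. Qed.

Lemma agree_le m n x y : (m <= n)%N -> agree n x y -> agree m x y.
Proof. by move=> mn xy i im; rewrite xy // (leq_trans im). Qed.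

Lemma agreeS n x y : agree n x y -> x n = y n -> agree n.+1 x y.
Proof.
by move=> xy xyn i; rewrite ltnS leq_eqVlt => /orP[/eqP ->|/xy].
Qed.

Lemma first_disagreement x y : x <> y -> exists2 n, agree n x y & x n <> y n.
Proof.
move=> xy.
have /ex_minnP[n /eqP xyn nmin] : exists n, x n != y n.
  apply/not_existsP => xyE; apply: xy; apply/funext => n.
  by apply/eqP/negPn/negP/xyE.
exists n => // i ni; apply/eqP/negPn/negP => /nmin.
by rewrite leqNgt ni.
Qed.

(** * Slopes encoding points of the Cantor set *)

Section Slope.
Variable R : realType.
Implicit Types x y : bits.

(** With base 4 and digits 0 and 1, the tail after [n] digits is at most a third of [4^-n]. Hence
    the threshold [4^-n / 2] tells agreement on [n] digits from disagreement; in base 2 distinct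
    sequences could share a value. *)
Definition slope_sum x n : R := \sum_(i < n) (x i)%:R * 4^-1 ^+ i.+1.

Definition slope x : R := sup (range (slope_sum x)).

Let w n : R := 4^-1 ^+ n.

Let w_gt0 n : 0 < w n. Proof. by rewrite exprn_gt0 // invr_gt0. Qed.

Let wS n : w n.+1 = w n / 4. Proof. by rewrite /w exprSr. Qed.

Lemma slope_sumS x n :
  slope_sum x n.+1 = slope_sum x n + (x n)%:R * 4^-1 ^+ n.+1.
Proof. by rewrite /slope_sum big_ord_recr. Qed.

Lemma slope_sum_agree n x y : agree n x y -> slope_sum x n = slope_sum y n.
Proof. by move=> xy; apply: eq_bigr => i _; rewrite xy. Qed.

Lemma slope_sum_tail x n m :
  slope_sum x n <= slope_sum x (n + m)%N <= slope_sum x n + (w n - w (n + m)) / 3.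
Proof.
elim: m => [|m /andP[IH1 IH2]]; first by rewrite addn0 subrr mul0r addr0 lexx.
rewrite addnS slope_sumS -/(w _) wS; have := w_gt0 (n + m).
rewrite -/(w (n + m)) in IH2 *.
by move=> *; apply/andP; case: (x _) => /=; split; lra.
Qed.

Lemma slope_sum_le x n m : slope_sum x m <= slope_sum x n + w n / 3.
Proof.
have [nm|/ltnW mn] := leqP n m.
  have := slope_sum_tail x n (m - n); rewrite subnKC //.
  by have := w_gt0 m; lra.
have := slope_sum_tail x m (n - m); rewrite subnKC //.
by have := w_gt0 n; lra.
Qed.

Lemma slope_ge x n : slope_sum x n <= slope x.
Proof.
apply: ub_le_sup; last by exists n.
by exists (slope_sum x 0 + w 0 / 3) => _ [m _ <-]; exact: slope_sum_le.
Qed.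

Lemma slope_le x n : slope x <= slope_sum x n + w n / 3.
Proof.
apply: ge_sup; first by exists (slope_sum x 0), 0%N.
by move=> _ [m _ <-]; exact: slope_sum_le.
Qed.

Lemma slope_agree n x y : agree n x y -> `|slope x - slope y| < w n / 2.
Proof.
move=> xy; have := slope_sum_agree xy.
have := slope_ge x n; have := slope_ge y n.
have := slope_le x n; have := slope_le y n; have := w_gt0 n.
by move=> *; rewrite ltr_norml; lra.
Qed.

(** The first differing digit, at [i < n], contributes [4^-(i+1)], and the tails can make up for at
    most a third of it. *)
Lemma slope_disagree n x y : ~ agree n x y -> w n / 2 < `|slope x - slope y|.
Proof.
move=> nxy.
have [i axy xyi] : exists2 i, agree i x y & x i <> y i.
  by apply: first_disagreement => xy; apply: nxy; rewrite xy.
have lin : (i < n)%N.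
  by rewrite ltnNge; apply/negP => /agree_le /(_ axy).
have win : w n <= w i.+1 by apply: ler_wiXn2l => //; lra.
have := slope_sum_agree axy; have := w_gt0 n.
have := slope_ge x i.+1; have := slope_ge y i.+1.
have := slope_le x i.+1; have := slope_le y i.+1.
move: win; rewrite !slope_sumS -/(w _) ltr_normr.
by case: (x i) (y i) xyi => -[] // _ /= *; apply/orP; [left|right]; lra.
Qed.

Lemma slope_ge0 x : 0 <= slope x.
Proof. by have := slope_ge x 0; rewrite /slope_sum big_ord0. Qed.

Lemma slope_le1 x : slope x <= 1.
Proof.
by have := slope_le x 0; rewrite /slope_sum /w big_ord0 expr0; lra.
Qed.

Lemma w_small e : 0 < e -> exists n, w n < e.
Proof.
move=> e0; have : (fun n => w n) @ \oo --> (0 : R).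
  by apply: cvg_expr; rewrite ger0_norm; lra.
move/cvgr0Pnorm_lt => /(_ e e0)[n _ /(_ n) /= H].
by exists n; apply: le_lt_trans (H _) => //; exact: ler_norm.
Qed.

End Slope.

(** * The fan as a subset of the plane *)

Definition fan_set (R : realType) (f : bits -> R) : set (R * R) :=
  [set z | z = (0, 0) \/ exists x, 0 < z.1 <= f x /\ z.2 = z.1 * slope R x].

Definition fan (R : realType) (f : bits -> R) : Type := set_type (fan_set f).

Section FanMetric.
Variables (R : realType) (f : bits -> R).
Implicit Types z w : fan f.

Definition fan_dist z w : R :=
  `|(\val z).1 - (\val w).1| + `|(\val z).2 - (\val w).2|.

HB.instance Definition _ := Choice.on (fan f).

Lemma fan_distxx z : fan_dist z z = 0.
Proof. by rewrite /fan_dist !subrr !normr0 addr0. Qed.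

Lemma fan_dist_eq0 z w : fan_dist z w = 0 -> z = w.
Proof.
move/eqP; rewrite paddr_eq0 // !normr_eq0 !subr_eq0 => /andP[/eqP e1 /eqP e2].
by apply: val_inj; move: e1 e2; case: (\val z) (\val w) => ? ? [] /= ? ? -> ->.
Qed.

Lemma fan_dist_sym z w : fan_dist z w = fan_dist w z.
Proof. by rewrite /fan_dist distrC [X in _ + X]distrC. Qed.

Lemma fan_dist_triangle u z w : fan_dist z w <= fan_dist z u + fan_dist u w.
Proof. by rewrite /fan_dist addrACA lerD // ler_distD. Qed.

HB.instance Definition _ := isMetric.Build R (fan f)
  fan_distxx fan_dist_eq0 fan_dist_sym fan_dist_triangle.

Lemma fan_nbhsP (z : fan f) (U : set (fan f)) :
  nbhs z U <-> exists2 e, 0 < e & forall w, fan_dist z w < e -> U w.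
Proof.
have ballE e : ball z e = [set w | fan_dist z w < e] by exact: ballEmdist.
split.
  by move=> /nbhs_ballP[e e0]; rewrite ballE => eU; exists e => // w /eU.
move=> [e e0 eU]; apply/nbhs_ballP; exists e => //.
Qed.

End FanMetric.

Lemma lipschitz1_continuous (R : realType) (T : metricType R) (g : T -> R) :
  (forall z w, `|g z - g w| <= mdist z w) -> continuous g.
Proof.
move=> gL z; apply/cvgrPdist_lt => e e0.
apply/nbhs_ballP; exists e => // w; rewrite ballEmdist.
exact: le_lt_trans (gL _ _).
Qed.

Lemma gap_continuous (R : realType) (T : topologicalType) (g h : T -> R)
    (a b : R) : continuous g -> continuous h ->
  continuous (fun z => g z * a - `|h z - g z * b|).
Proof.
move=> cg ch z; apply: cvgB; first by apply: cvgM; [exact: cg|exact: cvg_cst].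
apply: cvg_norm; apply: cvgB; first exact: ch.
by apply: cvgM; [exact: cg|exact: cvg_cst].
Qed.

Section FanTopology.
Variables (R : realType) (f : bits -> R).
Hypothesis f_le1 : forall x, f x <= 1.
Implicit Types (x y : bits) (z : fan f).

Lemma apex_subproof : fan_set f (0, 0). Proof. by left. Qed.

Definition apex : fan f := to_set_type apex_subproof.

Lemma leg_subproof x t : 0 < t <= f x -> fan_set f (t, t * slope R x).
Proof. by move=> tx; right; exists x. Qed.

(** Parameters outside []0, f x]], in particular [0], default to the apex, which makes [leg]
    total. *)
Definition leg x (t : R) : fan f :=
  if pselect (0 < t <= f x) is left tx then to_set_type (leg_subproof tx)
  else apex.

Definition height z : R := (\val z).1.

Lemma val_leg x t : 0 <= t <= f x -> \val (leg x t) = (t, t * slope R x).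
Proof.
move=> /andP[]; rewrite le_eqVlt => /orP[/eqP <- fx|t0 tx].
  rewrite /leg; case: pselect => [tx|_] /=; last by rewrite mul0r.
  by have := tx; rewrite ltxx.
by rewrite /leg; case: pselect => [//|[]]; rewrite t0 tx.
Qed.

Lemma height_leg x t : 0 <= t <= f x -> height (leg x t) = t.
Proof. by move=> tx; rewrite /height val_leg. Qed.

Lemma leg0 x : leg x 0 = apex.
Proof. by rewrite /leg; case: pselect => // tx; have := tx; rewrite ltxx. Qed.

Lemma fanP z : z = apex \/ exists x t, 0 < t <= f x /\ z = leg x t.
Proof.
have [z0|[x [tx z2]]] : fan_set f (\val z) by apply/set_mem/(valP z).
  by left; exact: val_inj.
right; exists x, (\val z).1; split => //; apply: val_inj.
rewrite val_leg; last by case/andP: tx => /ltW -> ->.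
by rewrite -z2; case: (\val z).
Qed.

Lemma leg_inj x y s t : 0 < t <= f x -> 0 < s <= f y -> leg x t = leg y s ->
  x = y /\ t = s.
Proof.
move=> /andP[t0 tx] /andP[s0 sy] /(congr1 val).
rewrite !val_leg ?(ltW t0) ?(ltW s0) // => -[-> /(mulfI (lt0r_neq0 s0)) xy].
split=> //; apply: contrapT => /first_disagreement[n _ xyn].
have /(@slope_disagree R) : ~ agree n.+1 x y by move/(_ n (ltnSn n)).
rewrite xy subrr normr0 ltNge divr_ge0 // exprn_ge0 //; lra.
Qed.

Lemma leg_neq_apex x t : 0 < t <= f x -> leg x t <> apex.
Proof.
move=> /andP[t0 tx] /(congr1 height).
by rewrite height_leg ?(ltW t0) //= /height /= => t0'; rewrite t0' ltxx in t0.
Qed.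

Lemma fan_dist_leg x y s t : 0 <= t <= f x -> 0 <= s <= f y ->
  fan_dist (leg x t) (leg y s) <= 2 * `|t - s| + `|slope R x - slope R y|.
Proof.
move=> tx sy; rewrite /fan_dist !val_leg //=.
have -> : t * slope R x - s * slope R y =
    (t - s) * slope R x + s * (slope R x - slope R y) by ring.
have h1 : `|(t - s) * slope R x| <= `|t - s|.
  by rewrite normrM (ger0_norm (slope_ge0 R x)) ler_piMr // slope_le1.
have h2 : `|s * (slope R x - slope R y)| <= `|slope R x - slope R y|.
  case/andP: sy => s0 sy; rewrite normrM (ger0_norm s0) ler_piMl //.
  exact: le_trans sy (f_le1 _).
have := ler_normD ((t - s) * slope R x) (s * (slope R x - slope R y)).
by move: h1 h2; lra.
Qed.

Lemma height_dist z w : `|height z - height w| <= fan_dist z w.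
Proof. by rewrite /fan_dist lerDl. Qed.

Lemma height_continuous : continuous height.
Proof. exact: (@lipschitz1_continuous R (fan f) _ height_dist). Qed.

Lemma height2_continuous : continuous (fun z : fan f => (\val z).2).
Proof.
by apply: (@lipschitz1_continuous R (fan f)) => z w; rewrite /= lerDr.
Qed.

Lemma open_height_gt a : open [set z | a < height z].
Proof.
apply: (@open_comp _ _ height [set u | a < u]); last exact: open_gt.
by move=> z _; exact: height_continuous.
Qed.

Lemma open_height_lt a : open [set z | height z < a].
Proof.
apply: (@open_comp _ _ height [set u | u < a]); last exact: open_lt.
by move=> z _; exact: height_continuous.
Qed.

(** Compares the slope of [z] with that of [x], multiplied through by the height: no division occurs
    and the function is continuous at the apex as well. It vanishes only there, so [cyl] and [cocyl]
    below are disjoint open sets covering the fan without its apex. *)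
Let gap n x z : R :=
  height z * (4^-1 ^+ n / 2) - `|(\val z).2 - height z * slope R x|.

Let gap_continuous n x : continuous (gap n x).
Proof.
exact: (@gap_continuous R (fan f) height (fun z => (\val z).2) _ _
  height_continuous height2_continuous).
Qed.

Definition cyl n x : set (fan f) := [set z | 0 < gap n x z].

Definition cocyl n x : set (fan f) := [set z | gap n x z < 0].

Lemma open_cyl n x : open (cyl n x).
Proof.
apply: (@open_comp _ _ (gap n x) [set u | 0 < u]); last exact: open_gt.
by move=> z _; exact: gap_continuous.
Qed.

Lemma open_cocyl n x : open (cocyl n x).
Proof.
apply: (@open_comp _ _ (gap n x) [set u | u < 0]); last exact: open_lt.
by move=> z _; exact: gap_continuous.
Qed.

Let gap_leg n x y t : 0 < t <= f y ->
  gap n x (leg y t) = t * (4^-1 ^+ n / 2 - `|slope R x - slope R y|).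
Proof.
move=> /andP[t0 ty]; rewrite /gap /height val_leg ?(ltW t0) //=.
by rewrite -mulrBr normrM (gtr0_norm t0) mulrBr distrC.
Qed.

Lemma cylP n x y t : 0 < t <= f y -> cyl n x (leg y t) <-> agree n x y.
Proof.
move=> ty; rewrite /cyl /= gap_leg // pmulr_rgt0 ?subr_gt0; last by case/andP: ty.
split; last exact: slope_agree.
by move=> H; apply: contrapT => /(@slope_disagree R); move: H; lra.
Qed.

Arguments cylP n x {y t}.

Lemma cocylP n x y t : 0 < t <= f y -> cocyl n x (leg y t) <-> ~ agree n x y.
Proof.
move=> ty; rewrite /cocyl /= gap_leg // pmulr_rlt0 ?subr_lt0; last by case/andP: ty.
split; last exact: slope_disagree.
by move=> H /(@slope_agree R); move: H; lra.
Qed.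

Arguments cocylP n x {y t}.

(** With [nbhs_leg] this gives neighbourhood bases off the apex: agreement of bits together with
    closeness of heights. *)
Lemma leg_nbhs x t (U : set (fan f)) : 0 <= t <= f x -> nbhs (leg x t) U ->
  exists n e, 0 < e /\ forall y s, agree n x y -> `|t - s| < e ->
    0 <= s <= f y -> U (leg y s).
Proof.
move=> tx /fan_nbhsP[e e0 eU]; have e3 : 0 < e / 3 by rewrite divr_gt0.
have [n wn] := @w_small R _ e3.
exists n, (e / 3); split => // y s xy ts sy; apply: eU.
have := fan_dist_leg tx sy; have := @slope_agree R _ _ _ xy.
have : 0 < 4^-1 ^+ n :> R by rewrite exprn_gt0 // invr_gt0.
by move: ts wn; lra.
Qed.

Lemma nbhs_leg x t n e : 0 < t <= f x -> 0 < e ->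
  nbhs (leg x t) [set z | exists y s,
    [/\ agree n x y, `|t - s| < e, 0 < s <= f y & z = leg y s]].
Proof.
move=> tx e0.
have h : height (leg x t) = t by rewrite height_leg //; case/andP: tx => /ltW ->.
have := open_nbhs_nbhs (conj (@open_cyl n x) ((cylP n x tx).2 (fun _ _ => erefl))).
have : nbhs (leg x t) [set z | `|t - height z| < e].
  by have /cvgrPdist_lt := @height_continuous (leg x t); rewrite h; apply.
apply: filterS2 => z hz cz; have [z0|[y [s [sy zE]]]] := fanP z.
  by move: cz; rewrite z0 /cyl /gap /height /= !mul0r subrr normr0 subrr ltxx.
move: cz hz; rewrite /= zE => /(cylP n x sy) xy; rewrite height_leg => [ts|].
  by exists y, s.
by case/andP: sy => /ltW ->.
Qed.

End FanTopology.

(** * Compact subspaces, clamping and arcs *)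

Lemma compact_set_type (T : topologicalType) (A : set T) :
  compact A -> compact [set: set_type A].
Proof.
move=> cA F PF _.
have [p [Ap clp]] : A `&` cluster (set_val @ F) !=set0.
  by apply: cA; apply: (@filterE _ F) => a; exact: set_valP.
exists (to_set_type Ap); split => // B C FB /= [_ [[D oD <-] Dp DC]].
have [_ [[b Bb <-] Db]] : (set_val @` B) `&` D !=set0.
  apply: clp; last exact: open_nbhs_nbhs.
  by apply: (@filterS _ F _ B) => // b Bb; exists b.
by exists b; split => //; exact: DC.
Qed.

Lemma hausdorff_set_type (T : topologicalType) (A : set T) :
  hausdorff_space T -> hausdorff_space (set_type A).
Proof.
move=> hT x y xy; apply: val_inj; apply: hT => B C xB yC.
have [a [Ba Ca]] := xy (set_val @^-1` B) (set_val @^-1` C)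
  (@set_val_continuous _ _ x _ xB) (@set_val_continuous _ _ y _ yC).
by exists (\val a).
Qed.

Lemma injective_compact_homeo (S T : topologicalType) (f : S -> T) :
  compact [set: S] -> hausdorff_space T -> injective f -> continuous f ->
  exists2 g : S -> set_type (range f), homeomorphism g &
    forall s, set_val (g s) = f s.
Proof.
move=> cS hT fI cf.
have fP s : range f (f s) by exists s.
have gP (a : set_type (range f)) : exists s, f s = set_val a.
  by have [s _ <-] : range f (set_val a) := set_valP a; exists s.
have [g gE] := choice gP.
exists (fun s => to_set_type (fP s)) => //; exists g.
have gK : cancel g (fun s => to_set_type (fP s)).
  by move=> a; apply: val_inj; exact: gE.
have fK : cancel (fun s => to_set_type (fP s)) g.
  by move=> s; apply: fI; rewrite gE.
have cf' : continuous (fun s => to_set_type (fP s)).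
  exact: continuous_set_val.
by split => //; apply: compact_hausdorff_inverse cf' => //; exact: hausdorff_set_type.
Qed.

Section Clamp.
Variable R : realType.

(** Retracting the line onto an interval lets the parametrisation of a leg be a continuous map on
    all of [R] rather than on a subspace. *)
Definition clamp (a b r : R) : R := Num.max a (Num.min r b).

Lemma clamp_id a b r : a <= r <= b -> clamp a b r = r.
Proof. by move=> /andP[ar rb]; rewrite /clamp (min_idPl rb) (max_idPr ar). Qed.

Lemma clamp_itv a b r : a <= b -> a <= clamp a b r <= b.
Proof. by move=> ab; rewrite /clamp le_max lexx ge_max ab ge_min lexx orbT. Qed.

Lemma clamp_lipschitz a b r s : `|clamp a b r - clamp a b s| <= `|r - s|.
Proof.
have := ler_norm (r - s); have := ler_norm (s - r); rewrite distrC ler_norml.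
have clE u : clamp a b u = if u < b then (if a < u then u else a)
                           else (if a < b then b else a).
  by rewrite /clamp /Num.max /Num.min; case: (u < b).
rewrite !clE; case: (ltP r b) => ?; case: (ltP s b) => ?; repeat case: ifPn => [?|]; rewrite -?leNgt => *; lra.
Qed.

Lemma clamp_continuous a b : continuous (clamp a b).
Proof.
move=> r; apply/cvgrPdist_lt => e e0.
apply/nbhs_ballP; exists e => // s; exact: le_lt_trans (clamp_lipschitz _ _ _ _).
Qed.

Lemma unit_interval_connected : connected [set: unit_interval R].
Proof.
have cP r : `[0, 1]%classic (clamp 0 1 r) by rewrite /= in_itv /= clamp_itv.
have -> : [set: unit_interval R] = (fun r => to_set_type (cP r)) @` `[0, 1].
  apply/seteqP; split => // u _; exists (\val u); first exact/set_mem/(valP u).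
  apply: val_inj => /=; rewrite clamp_id //.
  by have /set_mem := valP u; rewrite /= in_itv.
apply: connected_continuous_connected; first exact: segment_connected.
apply: continuous_subspaceT; apply: continuous_set_val.
exact: clamp_continuous.
Qed.

Lemma unit_interval_compact : compact [set: unit_interval R].
Proof. by apply: compact_set_type; exact: segment_compact. Qed.

End Clamp.

Lemma arc_closed_connected (R : realType) (T : topologicalType) (A : set T) x :
  hausdorff_space T -> arc_with_endpoint R A x ->
  [/\ closed A, connected A, A x & exists2 y, A y & y <> x].
Proof.
move=> hT [f [g [fK gK cf cg]] f0].
have cAf : continuous (set_val \o f).
  by move=> u; apply: continuous_comp; [exact: cf|exact: set_val_continuous].
have AE : (set_val \o f) @` [set: unit_interval R] = A.
  apply/seteqP; split => [_ [u _ <-]|a Aa]; first exact: set_valP.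
  by exists (g (to_set_type Aa)) => //=; rewrite gK.
split.
- rewrite -AE; apply: compact_closed => //; apply: continuous_compact.
    exact: continuous_subspaceT.
  exact: unit_interval_compact.
- rewrite -AE; apply: connected_continuous_connected.
    exact: unit_interval_connected.
  exact: continuous_subspaceT.
- by rewrite -f0; exact: set_valP.
- exists (set_val (f (unit_interval1 R))); first exact: set_valP.
  rewrite -f0 => /val_inj/(can_inj fK)/(congr1 val)/= /eqP.
  by rewrite oner_eq0.
Qed.

Lemma affine_continuous (R : realType) (T : topologicalType) (g : T -> R)
    (a c : R) : continuous g -> continuous (fun u => a + g u * c).
Proof.
move=> cg u; apply: cvgD; first exact: cvg_cst.
by apply: cvgM; [exact: cg|exact: cvg_cst].
Qed.

(** * The endpoints are the tips *)

Section FanEndpoints.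
Variables (R : realType) (f : bits -> R).
Hypothesis f_le1 : forall x, f x <= 1.
Implicit Types (x y : bits) (z : fan f).

Lemma fan_hausdorff : hausdorff_space (fan f).
Proof. exact: (@metric_hausdorff R (fan f)). Qed.

Lemma leg_clamp_continuous x : 0 <= f x ->
  continuous (fun r : R => leg f x (clamp 0 (f x) r)).
Proof.
move=> fx r U /(leg_nbhs f_le1 (clamp_itv _ fx))[n [e [e0 H]]].
have rn : nbhs r [set s | `|clamp 0 (f x) r - clamp 0 (f x) s| < e].
  exact: (cvgrPdist_lt _ _).1 (@clamp_continuous R 0 (f x) r) _ e0.
suff : nbhs r [set s | U (leg f x (clamp 0 (f x) s))] by [].
apply: filterS rn => s rs; apply: H => //; exact: clamp_itv.
Qed.

Definition leg_path x (a b : R) (u : unit_interval R) : fan f :=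
  leg f x (clamp 0 (f x) (a + \val u * (b - a))).

Lemma leg_pathP x a b u : 0 <= a <= f x -> 0 <= b <= f x ->
  exists t, [/\ leg_path x a b u = leg f x t, t = a + \val u * (b - a),
    0 <= t <= f x & (a <= t <= b) || (b <= t <= a)].
Proof.
move=> /andP[a0 ax] /andP[b0 bx].
have /andP[u0 u1] : 0 <= \val u <= 1.
  by have /set_mem := valP u; rewrite /= in_itv.
exists (a + \val u * (b - a)).
have h1 : 0 <= a + \val u * (b - a) <= f x by apply/andP; split; nra.
split => //; first by rewrite /leg_path clamp_id.
by have [ab|/ltW ba] := leP a b; apply/orP; [left|right]; apply/andP; split; nra.
Qed.

Lemma leg_arc x a b : 0 <= a <= f x -> 0 <= b <= f x -> a != b ->
  arc_with_endpoint R (range (leg_path x a b)) (leg f x a).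
Proof.
move=> ax bx ab.
have fx : 0 <= f x by case/andP: ax => /le_trans h /h.
have [g hg gE] : exists2 g : _ -> set_type (range (leg_path x a b)),
    homeomorphism g & forall s, set_val (g s) = leg_path x a b s.
  apply: injective_compact_homeo.
  - exact: unit_interval_compact.
  - exact: fan_hausdorff.
  - move=> u v; have [t [-> -> tx _]] := leg_pathP u ax bx.
    have [s [-> -> sx _]] := leg_pathP v ax bx.
    move=> /(congr1 (@height R f)); rewrite !height_leg // => /addrI.
    by move/mulIf => /(_ _); rewrite subr_eq0 eq_sym => /(_ ab)/val_inj.
  - move=> u; apply: (@continuous_comp _ _ _
      (fun u : unit_interval R => a + \val u * (b - a))
      (fun r => leg f x (clamp 0 (f x) r))); last exact: leg_clamp_continuous.
    exact: (@affine_continuous R (unit_interval R) (fun u => \val u) a (b - a)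
      (@set_val_continuous R `[0, 1]%classic)).
exists g => //; rewrite gE.
have [t [-> -> _ _]] := leg_pathP (unit_interval0 R) ax bx.
by rewrite /= mul0r addr0.
Qed.

Lemma leg_order1 x : 0 < f x -> order_at_least R 1 (leg f x (f x)).
Proof.
move=> fx; exists (fun=> range (leg_path x (f x) 0)) => [i|i j].
  by apply: leg_arc; rewrite ?lexx ?(ltW fx) // gt_eqF.
by rewrite !ord1 eqxx.
Qed.

Lemma ord2P (P : 'I_2 -> 'I_2 -> Prop) : (forall i j, P i j -> P j i) ->
  P ord0 ord_max -> forall i j, i != j -> P i j.
Proof.
move=> Psym P01 i j.
have h (k : 'I_2) : k = ord0 \/ k = ord_max.
  by case: k => -[|[|//]] ?; [left|right]; exact: val_inj.
by case: (h i) => ->; case: (h j) => -> // _; exact: Psym.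
Qed.

Lemma interior_order2 x t : 0 < t < f x -> order_at_least R 2 (leg f x t).
Proof.
move=> /andP[t0 tx].
have tI : 0 <= t <= f x by rewrite (ltW t0) (ltW tx).
have fI : 0 <= f x <= f x by rewrite lexx ltW // (lt_trans t0).
have oI : 0 <= (0 : R) <= f x by rewrite !lexx ltW // (lt_trans t0).
exists (fun i : 'I_2 => range (leg_path x t (if i == ord0 then 0 else f x))).
  move=> i; case: ifP => _; first by apply: leg_arc => //; rewrite gt_eqF.
  by apply: leg_arc => //; rewrite lt_eqF.
apply: ord2P => [i j|]; first by rewrite setIC.
rewrite /=.
apply/seteqP; split => [z [[u _ uz] [v _ vz]]|_ ->].
  have [r [rE _ rI rt]] := leg_pathP u tI oI.
  have [s [sE _ sI st]] := leg_pathP v tI fI.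
  have rs : r = s.
    have : height (leg f x r) = height (leg f x s) by rewrite -rE -sE uz vz.
    by rewrite !height_leg.
  rewrite -uz rE /=; congr (leg f x _); move: rt st; rewrite rs.
  by move=> /orP[]/andP[? ?] /orP[]/andP[? ?]; lra.
split; exists (unit_interval0 R) => //.
  have [r [-> -> _ _]] := leg_pathP (unit_interval0 R) tI oI.
  by rewrite /= mul0r addr0.
have [r [-> -> _ _]] := leg_pathP (unit_interval0 R) tI fI.
by rewrite /= mul0r addr0.
Qed.

Lemma apex_order2 x y : x <> y -> 0 < f x -> 0 < f y ->
  order_at_least R 2 (apex f).
Proof.
move=> xy fx fy.
have fxI : 0 <= f x <= f x by rewrite lexx ltW.
have fyI : 0 <= f y <= f y by rewrite lexx ltW.
have oxI : 0 <= (0 : R) <= f x by rewrite !lexx ltW.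
have oyI : 0 <= (0 : R) <= f y by rewrite !lexx ltW.
exists (fun i : 'I_2 => if i == ord0 then range (leg_path x 0 (f x))
                        else range (leg_path y 0 (f y))).
  move=> i; case: ifP => _; [rewrite -(leg0 f x)|rewrite -(leg0 f y)];
    by apply: leg_arc => //; rewrite lt_eqF.
apply: ord2P => [i j|]; first by rewrite setIC.
rewrite /=; apply/seteqP; split => [z [[u _ uz] [v _ vz]]|_ ->].
  have [r [rE _ rI _]] := leg_pathP u oxI fxI.
  have [s [sE _ sI _]] := leg_pathP v oyI fyI.
  have rs : leg f x r = leg f y s by rewrite -rE -sE uz vz.
  have : r = s.
    have : height (leg f x r) = height (leg f y s) by rewrite rs.
    by rewrite !height_leg.
  move=> rs'; rewrite -uz rE /=; case/andP: (rI); rewrite le_eqVlt.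
  move=> /orP[/eqP <- _|r0 rx]; first by rewrite leg0.
  have rI' : 0 < r <= f x by rewrite r0.
  have sI' : 0 < s <= f y by rewrite -rs' r0 rs'; case/andP: sI.
  by have [/xy] := leg_inj rI' sI' rs.
split; exists (unit_interval0 R) => //.
  have [r [-> -> _ _]] := leg_pathP (unit_interval0 R) oxI fxI.
  by rewrite /= mul0r addr0 leg0.
have [r [-> -> _ _]] := leg_pathP (unit_interval0 R) oyI fyI.
by rewrite /= mul0r addr0 leg0.
Qed.

(* The closedness of [A] matters: a connected set that is not closed may reach
   the tip of a leg without running along that leg. *)
Lemma closed_connected_at_tip (A : set (fan f)) x z : 0 < f x ->
  closed A -> connected A -> A (leg f x (f x)) -> A z -> z <> leg f x (f x) ->
  exists2 s : R, 0 <= s < f x & forall t : R, s < t < f x -> A (leg f x t).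
Proof.
move=> fx clA coA Atip Az ztip.
(* [s] is the height of [z] if [z] lies on the leg of [x], and [0] otherwise; so [z] cannot be in
   every cylinder around [x] and also above a height [t > s]. *)
have [s sx sz] : exists2 s : R, 0 <= s < f x &
    forall t : R, s < t -> 0 < t -> (forall n, cyl n x z) -> ~ t < height z.
  have [->|[y [r [ry zE]]]] := fanP z.
    by exists 0 => [|t t0 _ _]; rewrite ?lexx // /height /= ltNge ltW.
  have rI : 0 <= r <= f y by case/andP: ry => /ltW -> ->.
  have [xy|xy] := pselect (x = y); last first.
    exists 0 => [|t t0 _ H]; first by rewrite lexx.
    exfalso; apply: xy; apply/funext => i.
    have := H i.+1; rewrite zE => /(cylP i.+1 x ry); apply; exact: ltnSn.
  exists r => [|t rt _ _]; last by rewrite zE height_leg // ltNge ltW.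
  move: rI; rewrite xy => /andP[-> /=]; rewrite le_eqVlt => /orP[/eqP ry'|//].
  by exfalso; apply: ztip; rewrite zE xy ry'.
exists s => // t /andP[st tx]; apply: contrapT => nAt.
have t0 : 0 < t by case/andP: sx => s0 _; apply: le_lt_trans st.
have tI : 0 <= t <= f x by rewrite !ltW.
have [n [e [e0 H]]] := leg_nbhs f_le1 tI (open_nbhs_nbhs (conj (closed_openC clA) nAt)).
(* If [A] misses [leg f x t], it misses a neighbourhood of this point; then the part of [A] above
   height [t] on legs close to [x] is clopen in [A] and contains the tip, so it is all of [A]. *)
suff {sz} sub m : (n <= m)%N -> A `<=` cyl m x `&` [set w | t < height w].
  apply: (sz t) => // [m|]; last by have [] := sub n (leqnn n) _ Az.
  have [+ _] := sub (maxn m n) (leq_maxr _ _) _ Az.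
  have [->|[y [r [ry ->]]]] := fanP z.
    by rewrite /cyl /= /height /= !mul0r subrr normr0 subrr ltxx.
  move=> /(cylP _ x ry) /(agree_le (leq_maxl _ _)) xy; exact/cylP.
move=> nm; apply: (@connected_open_split _ _ _
    (cocyl m x `|` [set w | height w < t])) => //.
- by apply: openI; [exact: open_cyl|exact: open_height_gt].
- by apply: openU; [exact: open_cocyl|exact: open_height_lt].
- move=> w Aw; have [->|[y [r [ry wE]]]] := fanP w; first by right; right.
  have hr : height w = r by rewrite wE height_leg //; case/andP: ry => /ltW ->.
  have [xy|xy] := pselect (agree m x y); last first.
    by right; left; rewrite wE; apply/cocylP.
  have [rt|tr|rt] := ltgtP r t.
  + by right; right; rewrite /= hr.
  + by left; split; rewrite /= ?hr // wE; apply/cylP.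
  + exfalso; apply: (H y r) (agree_le nm xy) _ _ _; rewrite -?wE //.
      by rewrite rt subrr normr0.
    by case/andP: ry => /ltW ->.
- apply/seteqP; split => // w [[_ [c1 h1]] [c2|h2]].
    by move: c1 c2; rewrite /cyl /cocyl /= => /lt_trans h /h; rewrite ltxx.
  by move: h1 h2; rewrite /= => /lt_trans h /h; rewrite ltxx.
- exists (leg f x (f x)); split => //; split.
    by apply/cylP; rewrite ?lexx ?fx.
  by rewrite /= height_leg // lexx ltW.
Qed.

(** Two arcs starting at a tip both contain a final stretch of the leg, so they meet away from the
    tip. *)
Lemma tip_order1 x : 0 < f x -> ~ order_at_least R 2 (leg f x (f x)).
Proof.
move=> fx [A arcA disjA].
have sP i : exists2 s : R, 0 <= s < f x & forall t : R, s < t < f x -> A i (leg f x t).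
  have [clA coA Atip [z Az zt]] := arc_closed_connected fan_hausdorff (arcA i).
  exact: closed_connected_at_tip Az zt.
have [s0 /andP[s00 s0x] H0] := sP ord0; have [s1 /andP[s10 s1x] H1] := sP ord_max.
pose t := (Num.max s0 s1 + f x) / 2.
have [t0 t1 tx] : [/\ s0 < t, s1 < t & t < f x].
  by rewrite /t; case: (leP s0 s1) => h; split; lra.
have : (A ord0 `&` A ord_max) (leg f x t) by split; [apply: H0|apply: H1]; rewrite ?t0 ?t1.
rewrite disjA // => /(congr1 (@height R f)); rewrite !height_leg.
- by move=> tE; rewrite tE ltxx in tx.
- by rewrite lexx ltW.
- by rewrite (ltW tx) ltW // (le_lt_trans s00).
Qed.

Hypothesis two_legs : exists x y, [/\ x <> y, 0 < f x & 0 < f y].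

Lemma fan_endpoints : endpoints R (fan f) = [set leg f x (f x) | x in [set x | 0 < f x]].
Proof.
apply/seteqP; split => [z [z1 z2]|_ [x fx <-]]; last first.
  by split; [exact: leg_order1|exact: tip_order1].
have [z0|[x [t [/andP[t0 tx] zE]]]] := fanP z.
  have [x [y [xy fx fy]]] := two_legs.
  by exfalso; apply: z2; rewrite z0; apply: apex_order2 fx fy.
exists x; first exact: lt_le_trans tx.
move: tx; rewrite le_eqVlt => /orP[/eqP <- //|tx].
by exfalso; apply: z2; rewrite zE; apply: interior_order2; rewrite t0.
Qed.

End FanEndpoints.

(** * Rigidity by counting marks *)

Section FanRigidity.
Variable R : realType.

Definition marks_at (f : bits -> R) (x : bits) : set R :=
  [set t | 0 < t < f x /\ forall n e, 0 < e ->
     exists y, [/\ agree n x y, 0 < f y & `|t - f y| < e]].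

(** What a construction of heights has to deliver. [mf_le1] and [mf_usc] give the embedding into the
    cone, [mf_three] singles out the apex, [mf_inj] and [mf_pos] let the counts recognise each leg
    in [S], and [mf_dense] extends what is known on the tips over [S] to all tips. *)
Record marked_fan (f : bits -> R) (S : set bits) (a : bits -> nat) : Prop := {
  mf_le1 : forall x, f x <= 1;
  mf_usc : forall x e, 0 < e -> exists n, forall y, agree n x y -> f y < f x + e;
  mf_three : exists x y z, [/\ x <> y, y <> z, x <> z, S x & S y /\ S z];
  mf_gt0 : forall x, S x -> 0 < f x;
  mf_card : forall x, S x -> marks_at f x #= `I_(a x);
  mf_none : forall x, 0 < f x -> ~ S x -> marks_at f x #= `I_0;
  mf_dense : forall x n e, 0 < f x -> 0 < e ->
    exists y, [/\ S y, agree n x y & `|f x - f y| < e];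
  mf_inj : forall x y, S x -> S y -> a x = a y -> x = y;
  mf_pos : forall x, S x -> (0 < a x)%N }.

Section OneFan.
Variables (f : bits -> R) (S : set bits) (a : bits -> nat).
Hypothesis mf : marked_fan f S a.

Let f_le1 := mf_le1 mf.

Local Notation "'apex'" := (apex f).
Local Notation leg := (leg f).

Let legc x (r : R) : fan f := leg x (clamp 0 (f x) r).

Lemma connected_leg x (s t : R) : 0 <= f x ->
  connected (legc x @` `[s, t]).
Proof.
move=> fx; apply: connected_continuous_connected; first exact: segment_connected.
by apply: continuous_subspaceT; exact: leg_clamp_continuous.
Qed.

Lemma joined_leg x s t : 0 < s <= f x -> 0 < t <= f x ->
  joined_off apex (leg x s) (leg x t).
Proof.
move=> /andP[s0 sx] /andP[t0 tx].
exists (legc x @` `[Num.min s t, Num.max s t]); split.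
- by apply: connected_leg; rewrite ltW // (lt_le_trans s0).
- exists s; first by rewrite /= in_itv /= ge_min le_max !lexx.
  by rewrite /legc clamp_id // ltW.
- exists t; first by rewrite /= in_itv /= ge_min le_max !lexx !orbT.
  by rewrite /legc clamp_id // ltW.
- move=> [r /=]; rewrite in_itv /= ge_min le_max => /andP[h1 h2].
  have rI : 0 < r <= f x by apply/andP; split; case/orP: h1; case/orP: h2; lra.
  rewrite /legc clamp_id; first exact: leg_neq_apex.
  by case/andP: rI => /ltW -> ->.
Qed.

(** Away from the apex, [cyl] and [cocyl] separate legs that differ in a bit. *)
Lemma joined_off_apex x y s t : 0 < s <= f x -> 0 < t <= f y ->
  joined_off apex (leg x s) (leg y t) -> x = y.
Proof.
move=> sx ty [C [cC Cx Cy nC]]; apply: contrapT => /first_disagreement[n _ xyn].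
have : C `<=` cyl n.+1 x.
  apply: (@connected_open_split _ _ _ (cocyl n.+1 x)) => //.
  - exact: open_cyl.
  - exact: open_cocyl.
  - move=> z Cz; have [z0|[u [r [ru zE]]]] := fanP z.
      by exfalso; apply: nC; rewrite -z0.
    rewrite zE; have [xu|xu] := pselect (agree n.+1 x u).
      by left; apply/cylP.
    by right; apply/cocylP.
  - apply/seteqP; split => // z [[_ c1] c2].
    by move: c1 c2; rewrite /cyl /cocyl /= => /lt_trans h /h; rewrite ltxx.
  - by exists (leg x s); split => //; apply/cylP.
move=> /(_ _ Cy) /(cylP _ _ ty) /(_ n (ltnSn n)); exact: xyn.
Qed.

Let two_legs : exists x y, [/\ x <> y, 0 < f x & 0 < f y].
Proof.
have [x [y [z [xy _ _ Sx [Sy _]]]]] := mf_three mf.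
by exists x, y; split => //; exact: (mf_gt0 mf).
Qed.

Lemma endpoint_tip z : endpoints R (fan f) z <->
  exists2 x, 0 < f x & z = leg x (f x).
Proof.
by rewrite (fan_endpoints f_le1 two_legs); split => -[x fx E]; exists x.
Qed.

Let tipI x : 0 < f x -> 0 < f x <= f x. Proof. by rewrite lexx => ->. Qed.

Lemma apex_separates : separates_endpoints R apex.
Proof.
move=> e e' /endpoint_tip[x fx ->] /endpoint_tip[y fy ->] ee' j.
by apply: ee'; rewrite (joined_off_apex (tipI fx) (tipI fy) j).
Qed.

(** Among three legs, two avoid a given point other than the apex, and their union joins their tips
    through the apex. *)
Lemma separates_apex z : separates_endpoints R z -> z = apex.
Proof.
move=> sz; have [//|[x [t [tx zE]]]] := fanP z; exfalso.
have [y [y' [yy' yx y'x fy fy']]] :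
    exists y y', [/\ y <> y', y <> x, y' <> x, 0 < f y & 0 < f y'].
  have [u [v [w [uv vw uw /(mf_gt0 mf) fu [/(mf_gt0 mf) fv /(mf_gt0 mf) fw]]]]] := mf_three mf.
  have [ux|ux] := pselect (u = x); first by exists v, w; split => //; rewrite -ux; apply: nesym.
  have [vx|vx] := pselect (v = x).
    by exists u, w; split => //; rewrite -vx; exact: nesym.
  by exists u, v.
apply: (sz (leg y (f y)) (leg y' (f y'))).
- by apply/endpoint_tip; exists y.
- by apply/endpoint_tip; exists y'.
- by move=> /(leg_inj (tipI fy) (tipI fy'))[].
have c0 u : 0 < f u -> clamp 0 (f u) 0 = 0.
  by move=> fu; rewrite clamp_id // lexx ltW.
have cf u : 0 < f u -> clamp 0 (f u) (f u) = f u.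
  by move=> fu; rewrite clamp_id // lexx ltW.
exists (legc y @` `[0, f y] `|` legc y' @` `[0, f y']); split.
- apply: connectedU; first 1 last.
  + by apply: connected_leg; exact: ltW.
  + by apply: connected_leg; exact: ltW.
  exists apex; split; exists 0; rewrite /= ?in_itv /= ?lexx ?ltW //.
    by rewrite /legc c0 // leg0.
  by rewrite /legc c0 // leg0.
- by left; exists (f y); rewrite /= ?in_itv /= ?lexx ?ltW // /legc cf.
- by right; exists (f y'); rewrite /= ?in_itv /= ?lexx ?ltW // /legc cf.
have noleg u : u <> x -> ~ (legc u @` `[0, f u]) z.
  move=> ux [r /=]; rewrite in_itv /= => /[dup] rI /andP[]; rewrite /legc clamp_id //.
  rewrite le_eqVlt zE => /orP[/eqP <- _|r0 ru].
    by rewrite leg0 => /esym; exact: leg_neq_apex.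
  have rI' : 0 < r <= f u by rewrite r0.
  by move=> /(leg_inj rI' tx)[].
by move=> [/noleg|/noleg]; exact.
Qed.

Lemma closure_endpointsP x t : 0 < t <= f x ->
  closure (endpoints R (fan f)) (leg x t) <->
  forall n e, 0 < e -> exists y, [/\ agree n x y, 0 < f y & `|t - f y| < e].
Proof.
move=> tx; split=> [cl n e e0|H U].
  have [z [/endpoint_tip[y fy ->]]] := cl _ (nbhs_leg n tx e0).
  move=> [u [s [xu ts su /(leg_inj (tipI fy) su)[yu fys]]]].
  by rewrite {}yu in fy fys; exists u; split => //; rewrite fys.
have tI : 0 <= t <= f x by case/andP: tx => /ltW ->.
move=> /(leg_nbhs f_le1 tI)[n [e [e0 nU]]]; have [y [xy fy ty]] := H n e e0.
exists (leg y (f y)); split; first by apply/endpoint_tip; exists y.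
by apply: nU => //; rewrite lexx ltW.
Qed.

Lemma marks_tip x : 0 < f x ->
  marks R apex (leg x (f x)) = leg x @` marks_at f x.
Proof.
move=> fx; apply/seteqP; split => [z [cz nz z0 jz]|_ [t [/andP[t0 tx] H] <-]].
  have [//|[y [t [ty zE]]]] := fanP z.
  have yx : y = x by apply: joined_off_apex ty (tipI fx) _; rewrite -zE.
  move: zE ty; rewrite {y}yx => zE /[dup] tI /andP[t0]; rewrite le_eqVlt.
  move=> /orP[/eqP tx|tx].
    by exfalso; apply: nz; apply/endpoint_tip; exists x; rewrite // zE tx.
  exists t => //; split; first by rewrite t0.
  by move: cz; rewrite zE => /(closure_endpointsP tI).
have tI : 0 < t <= f x by rewrite t0 ltW.
split.
- exact/closure_endpointsP.
- move=> /endpoint_tip[y fy /(leg_inj tI (tipI fy))[xy te]].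
  by move: tx; rewrite te xy ltxx.
- exact: leg_neq_apex.
- exact: joined_leg (tipI fx).
Qed.

Lemma card_marks_tip x : 0 < f x -> marks R apex (leg x (f x)) #= marks_at f x.
Proof.
move=> fx; rewrite marks_tip //; apply: inj_card_eq => t s.
move=> /set_mem[/andP[t0 tx] _] /set_mem[/andP[s0 sx] _] ts.
by have [] := leg_inj (_ : 0 < t <= f x) (_ : 0 < s <= f x) ts; rewrite ?t0 ?s0 ?ltW.
Qed.

End OneFan.

Lemma homeo_apex f g S T a b (mf : marked_fan f S a) (mg : marked_fan g T b)
    (h : fan f -> fan g) : homeomorphism h -> h (apex f) = apex g.
Proof.
move=> hh; apply: (separates_apex mg); apply: separates_endpoints_homeo => //.
exact: apex_separates mf.
Qed.

(** The image of the tip is again a tip with the same number of marks. As this number is positive,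
    the image belongs to a leg in [T], and equipotent initial segments of the naturals are equal. *)
Lemma homeo_special f g S T a b (mf : marked_fan f S a) (mg : marked_fan g T b)
    (h : fan f -> fan g) x : homeomorphism h -> S x ->
  exists y, [/\ T y, a x = b y & h (leg f x (f x)) = leg g y (g y)].
Proof.
move=> hh Sx; have fx := mf_gt0 mf Sx.
have /(endpoint_tip mg)[y gy hE] : endpoints R (fan g) (h (leg f x (f x))).
  by apply/endpoints_homeo => //; apply/(endpoint_tip mf); exists x.
have card : marks_at g y #= `I_(a x).
  have := card_marks_tip mg gy; rewrite card_eq_sym => /card_eq_trans; apply.
  rewrite -hE -(homeo_apex mf mg hh); apply/card_marks_homeo => //.
  by apply: card_eq_trans (mf_card mf Sx); exact: (card_marks_tip mf).
have [Ty|nTy] := pselect (T y).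
  exists y; split => //; apply/card_eq_II.
  by apply: card_eq_trans (mf_card mg Ty); rewrite card_eq_sym.
have /card_eq_II ax : `I_(a x) #= `I_0.
  by apply: card_eq_trans (mf_none mg gy nTy); rewrite card_eq_sym.
by have := mf_pos mf Sx; rewrite ax.
Qed.

(** Tips over [S] are fixed, as their counts differ. Any neighbourhoods of a tip and of its image
    then share a fixed tip over [S] by density and continuity, so the two points coincide. *)
Lemma marked_fan_rigid f S a : marked_fan f S a -> endpoint_rigid (fan f : metricType R).
Proof.
move=> mf h hh z /(endpoint_tip mf)[x fx ->].
have hS y : S y -> h (leg f y (f y)) = leg f y (f y).
  move=> Sy; have [u [Su au ->]] := homeo_special mf mf hh Sy.
  by rewrite (mf_inj mf Sy Su au).
apply: (@fan_hausdorff R f) => U V Uh Vx.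
have [_ [_ _ ch _]] := hh.
have fI : 0 <= f x <= f x by rewrite lexx ltW.
have hU : nbhs (leg f x (f x)) (h @^-1` U) := ch _ _ Uh.
have [n [e [e0 H]]] := leg_nbhs (mf_le1 mf) fI (filterI hU Vx).
have [y [Sy xy fxy]] := mf_dense mf n fx e0.
exists (leg f y (f y)).
have [] := H y (f y) xy fxy; last by rewrite /= hS.
by rewrite lexx ltW //; exact: (mf_gt0 mf).
Qed.

End FanRigidity.

(** * The fan as a subcontinuum of the Cantor fan *)

Local Open Scope quotient_scope.

Lemma agree_nbhs (n : nat) (x : cantor_space) :
  nbhs x [set y : cantor_space | agree n x y].
Proof.
elim: n => [|n IH]; first by apply: filterS filterT.
have xn : nbhs x [set y : cantor_space | x n = y n].
  have := @proj_continuous nat (fun=> bool) n x [set b | x n = b].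
  by apply; rewrite nbhs_principalE.
by apply: filterS2 IH xn => y; exact: agreeS.
Qed.

Lemma slope_continuous (R : realType) : continuous (slope R : cantor_space -> R).
Proof.
move=> x; apply/cvgrPdist_lt => e e0; have [n ne] := @w_small R e e0.
apply: filterS (agree_nbhs n x) => y /(@slope_agree R).
have : 0 < 4^-1 ^+ n :> R by rewrite exprn_gt0 // invr_gt0.
by move: ne; lra.
Qed.

Lemma fan_continuous (R : realType) (f : bits -> R) (T : topologicalType)
    (h : T -> fan f) : continuous (fun t => (\val (h t)).1) ->
  continuous (fun t => (\val (h t)).2) -> continuous h.
Proof.
move=> c1 c2 t U /fan_nbhsP[e e0 eU]; have e2 : 0 < e / 2 by lra.
suff : nbhs t [set s | U (h s)] by [].
have n1 : nbhs t [set s | `|(\val (h t)).1 - (\val (h s)).1| < e / 2].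
  exact: (cvgrPdist_lt _ _).1 (c1 t) _ e2.
have n2 : nbhs t [set s | `|(\val (h t)).2 - (\val (h s)).2| < e / 2].
  exact: (cvgrPdist_lt _ _).1 (c2 t) _ e2.
by apply: filterS2 n1 n2 => s /= h1 h2; apply: eU; rewrite /fan_dist; lra.
Qed.

Section ConeEmbedding.
Variables (R : realType) (f : bits -> R).
Hypothesis f_le1 : forall x, f x <= 1.
Hypothesis f_usc : forall x e, 0 < e ->
  exists n, forall y, agree n x y -> f y < f x + e.
Variables (x0 y0 : bits).
Hypotheses (xy0 : x0 <> y0) (fx0 : 0 < f x0) (fy0 : 0 < f y0).

Local Notation base := (cantor_space * unit_interval R)%type.

Definition to_cone : base -> cantor_fan R :=
  \pi_(quotient_topology {eq_quot (cone_equiv R cantor_space)}).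

Lemma to_coneP p q : to_cone p = to_cone q <-> cone_rel p q.
Proof. by split => [/eqquotP|?]; [|apply/eqquotP]. Qed.

(** The cone is collapsed at parameter [1], so height [t] sits at parameter [1 - t]. All of the
    level [1] is included, so that the set is a union of classes and contains the apex whatever the
    sign of [f]. *)
Definition under_graph : set base :=
  [set p | 1 - \val p.2 <= f p.1 \/ \val p.2 = 1].

Lemma compact_under_graph : compact under_graph.
Proof.
have cT : compact ([set: cantor_space] `*` [set: unit_interval R]).
  by apply: compact_setX; [exact: cantor_space_compact|exact: unit_interval_compact].
apply: (subclosed_compact _ cT) => //.
(* The complement is open: by upper semicontinuity a point strictly above the graph has a whole
   neighbourhood above it. *)
rewrite -[under_graph]setCK; apply: open_closedC; rewrite openE => -[c u] /= ncu.
have [u1 cu] : \val u < 1 /\ f c < 1 - \val u.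
  have /andP[_ ule] : 0 <= \val u <= 1.
    by have /set_mem := valP u; rewrite /= in_itv.
  split; last by rewrite ltNge; apply/negP => h; apply: ncu; left.
  by rewrite lt_neqAle ule andbT; apply/eqP => h; apply: ncu; right.
have e0 : 0 < (1 - \val u - f c) / 2 by lra.
have [n nP] := f_usc c e0.
have nu : nbhs u [set v : unit_interval R | `|\val u - \val v| <
    Num.min (1 - \val u) ((1 - \val u - f c) / 2)].
  have cv : continuous (fun v : unit_interval R => \val v).
    exact: (@set_val_continuous R `[0, 1]%classic).
  apply: (cvgrPdist_lt _ _).1 (cv u) _ _.
  by rewrite lt_min e0 andbT subr_gt0.
exists ([set y : cantor_space | agree n c y], [set v : unit_interval R |
    `|\val u - \val v| < Num.min (1 - \val u) ((1 - \val u - f c) / 2)]).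
  by split => //; exact: agree_nbhs.
move=> [y v] /= [/nP fy]; rewrite lt_min !ltr_norml => /andP[/andP[h1 h2] /andP[h3 h4]].
by move=> [|]; move: fy => /= *; lra.
Qed.

Definition cone_val1 (p : base) : R := 1 - \val p.2.
Definition cone_val2 (p : base) : R := (1 - \val p.2) * slope R p.1.

Let val2_continuous : continuous (fun p : base => \val p.2).
Proof.
move=> p; apply: (@continuous_comp _ _ _ snd (fun v : unit_interval R => \val v)).
  exact: cvg_snd.
exact: (@set_val_continuous R `[0, 1]%classic).
Qed.

Lemma cone_val1_continuous : continuous cone_val1.
Proof.
move=> p; apply: cvgB; first exact: cvg_cst.
exact: val2_continuous.
Qed.

Lemma cone_val2_continuous : continuous cone_val2.
Proof.
move=> p; apply: cvgM; first exact: cone_val1_continuous.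
apply: (@continuous_comp _ _ _ fst (slope R : cantor_space -> R)).
  exact: cvg_fst.
exact: slope_continuous.
Qed.

Let cone_rel_val1 p q : cone_rel p q -> cone_val1 p = cone_val1 q.
Proof.
move=> /orP[/eqP -> //|/andP[/eqP p1 /eqP q1]].
by rewrite /cone_val1 p1 q1.
Qed.

Let cone_rel_val2 p q : cone_rel p q -> cone_val2 p = cone_val2 q.
Proof.
move=> /orP[/eqP -> //|/andP[/eqP p1 /eqP q1]].
by rewrite /cone_val2 p1 q1 /= !subrr !mul0r.
Qed.

Let cone_val_fan p : under_graph p -> fan_set f (cone_val1 p, cone_val2 p).
Proof.
case: p => c u /= [h|h]; last first.
  by left; rewrite /cone_val1 /cone_val2 /= h subrr mul0r.
have /andP[_ ule] : 0 <= \val u <= 1.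
  by have /set_mem := valP u; rewrite /= in_itv.
move: ule; rewrite le_eqVlt => /orP[/eqP u1|u1].
  by left; rewrite /cone_val1 /cone_val2 /= u1 subrr mul0r.
by right; exists c; rewrite /cone_val1 /= subr_gt0 u1.
Qed.

Definition cone_copy : set (cantor_fan R) := to_cone @` under_graph.

Lemma cone_copy_compact : compact cone_copy.
Proof.
apply: continuous_compact; last exact: compact_under_graph.
by apply: continuous_subspaceT; exact: pi_continuous.
Qed.

Let copyP (k : set_type cone_copy) :
  exists2 p, under_graph p & to_cone p = set_val k.
Proof. by have [p up pk] : cone_copy (set_val k) := set_valP k; exists p. Qed.

Let repr_val1 p : cone_val1 (repr (to_cone p)) = cone_val1 p.
Proof. by apply: cone_rel_val1; apply/to_coneP; exact: reprK. Qed.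

Let repr_val2 p : cone_val2 (repr (to_cone p)) = cone_val2 p.
Proof. by apply: cone_rel_val2; apply/to_coneP; exact: reprK. Qed.

Let fan_of_subproof (k : set_type cone_copy) :
  fan_set f (cone_val1 (repr (set_val k)), cone_val2 (repr (set_val k))).
Proof.
by have [p up <-] := copyP k; rewrite repr_val1 repr_val2; exact: cone_val_fan.
Qed.

(** The map goes from the cone to the plane, where it is a formula constant on classes; continuity
    of its inverse then comes from compactness. *)
Definition fan_of_cone (k : set_type cone_copy) : fan f :=
  to_set_type (fan_of_subproof k).

Lemma fan_of_cone_continuous : continuous fan_of_cone.
Proof.
have c1 : continuous (cone_val1 \o repr : cantor_fan R -> R).
  apply: repr_comp_continuous; first exact: cone_val1_continuous.
  by move=> p q /eqP/to_coneP/cone_rel_val1 ->.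
have c2 : continuous (cone_val2 \o repr : cantor_fan R -> R).
  apply: repr_comp_continuous; first exact: cone_val2_continuous.
  by move=> p q /eqP/to_coneP/cone_rel_val2 ->.
apply: fan_continuous => k.
  apply: (@continuous_comp _ _ _ set_val (cone_val1 \o repr : cantor_fan R -> R)).
    exact: set_val_continuous.
  exact: c1.
apply: (@continuous_comp _ _ _ set_val (cone_val2 \o repr : cantor_fan R -> R)).
  exact: set_val_continuous.
exact: c2.
Qed.

Lemma val_fan_of_cone p (up : cone_copy (to_cone p)) :
  \val (fan_of_cone (to_set_type up)) = (cone_val1 p, cone_val2 p).
Proof. by rewrite /= repr_val1 repr_val2. Qed.

Lemma fan_of_cone_inj : injective fan_of_cone.
Proof.
move=> k l /(congr1 val) /= [].
have [p up pk] := copyP k; have [q uq ql] := copyP l.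
rewrite -pk -ql !repr_val1 !repr_val2 => v1 v2.
apply: val_inj; suff : to_cone p = to_cone q by rewrite pk ql.
apply/to_coneP; case: p q v1 v2 {up uq pk ql} => [c u] [d v].
rewrite /cone_val1 /cone_val2 /= => uv.
have {}uv : u = v by apply: val_inj; move: uv => /=; lra.
rewrite {}uv /cone_rel /=; have [->|v1] := eqVneq v (unit_interval1 R).
  by rewrite orbT.
have /mulfI h : 1 - \val v != 0.
  by apply: contra v1; rewrite subr_eq0 eq_sym => /eqP h; apply/eqP/val_inj.
move=> /h cd; suff -> : c = d by rewrite eqxx.
apply: contrapT => /first_disagreement[n _ xyn].
have /(@slope_disagree R) : ~ agree n.+1 c d by move/(_ n (ltnSn n)).
rewrite cd subrr normr0 ltNge divr_ge0 // exprn_ge0 //; lra.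
Qed.

Lemma unit_interval_mem (r : R) : 0 <= r <= 1 -> (`[0, 1]%classic : set R) r.
Proof. by rewrite /= in_itv. Qed.

Lemma fan_of_cone_apex :
  exists2 k, fan_of_cone k = apex f & set_val k = cone_point R.
Proof.
have up : cone_copy (cone_point R) by exists (point, unit_interval1 R) => //; right.
exists (to_set_type up) => //; apply: val_inj.
by rewrite val_fan_of_cone /cone_val1 /cone_val2 /= subrr mul0r.
Qed.

Lemma fan_of_cone_surj z : exists k, fan_of_cone k = z.
Proof.
have [->|[x [t [/andP[t0 tx] ->]]]] := fanP z.
  by have [k <- _] := fan_of_cone_apex; exists k.
have t1 : t <= 1 by apply: le_trans tx (f_le1 x).
have uI : 0 <= 1 - t <= 1 by apply/andP; split; lra.
have up : cone_copy (to_cone (x, to_set_type (unit_interval_mem uI))).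
  by eexists; last reflexivity; left; rewrite /= subKr.
exists (to_set_type up); apply: val_inj.
rewrite val_fan_of_cone /cone_val1 /cone_val2 /= subKr val_leg //.
by rewrite (ltW t0).
Qed.

Lemma fan_connected : connected [set: fan f].
Proof.
pose A x := (fun r => leg f x (clamp 0 (f x) r)) @` `[0, f x].
have -> : [set: fan f] = \bigcup_(x in [set x | 0 <= f x]) A x.
  apply/seteqP; split => // z _.
  have aA : A x0 (apex f).
    exists 0; first by rewrite /= in_itv /= lexx ltW.
    by rewrite clamp_id ?leg0 // lexx ltW.
  have [->|[x [t [/andP[t0 tx] ->]]]] := fanP z.
    by exists x0 => //; exact: ltW.
  exists x; first by rewrite /= ltW // (lt_le_trans t0).
  exists t; first by rewrite /= in_itv /= tx ltW.
  by rewrite clamp_id // tx ltW.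
apply: bigcup_connected => [|x fx].
  exists (apex f) => x fx; exists 0; first by rewrite /= in_itv /= lexx.
  by rewrite clamp_id ?leg0 // lexx.
apply: connected_continuous_connected; first exact: segment_connected.
by apply: continuous_subspaceT; exact: leg_clamp_continuous.
Qed.

Lemma fan_smooth : smooth_fan (fan f : metricType R).
Proof.
have cK : compact [set: set_type cone_copy].
  by apply: compact_set_type; exact: cone_copy_compact.
have [g gK] := choice fan_of_cone_surj.
have Kg : cancel fan_of_cone g by move=> k; apply: fan_of_cone_inj; rewrite gK.
have cg : continuous g.
  apply: (compact_hausdorff_inverse cK _ Kg gK fan_of_cone_continuous).
  exact: fan_hausdorff.
have coX := fan_connected.
split.
  split => //.
  - have -> : [set: fan f] = fan_of_cone @` [set: set_type cone_copy].
      by apply/seteqP; split => // z _; exists (g z).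
    apply: continuous_compact => //.
    by apply: continuous_subspaceT; exact: fan_of_cone_continuous.
  - exists (apex f), (leg f x0 (f x0)) => /esym; apply: leg_neq_apex.
    by rewrite fx0 lexx.
exists cone_copy; split; first exact: cone_copy_compact.
- have -> : cone_copy = (set_val \o g) @` [set: fan f].
    apply/seteqP; split => [k Kk|_ [z _ <-]]; last exact: set_valP.
    by exists (fan_of_cone (to_set_type Kk)) => //=; rewrite Kg.
  apply: connected_continuous_connected => //; apply: continuous_subspaceT.
  move=> z; apply: (@continuous_comp _ _ _ g set_val); first exact: cg.
  exact: set_val_continuous.
- exists g; first by exists fan_of_cone; split => //; exact: fan_of_cone_continuous.
  exists (apex f); last exact: apex_order2 xy0 fx0 fy0.
  by have [k <- kE] := fan_of_cone_apex; rewrite Kg.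
Qed.

End ConeEmbedding.

(** * Heights computed bit by bit *)

Section BitStates.
Implicit Types (x y : bits) (n : nat).

Fixpoint last_one x n : nat :=
  if n is n'.+1 then (if x n' then n else last_one x n') else 0.

(** The least significant bit comes first, so trailing zeros do not change the number and each
    finite sequence gets a single one. *)
Fixpoint code x n : nat :=
  if n is n'.+1 then (code x n' + x n' * 2 ^ n')%N else 0.

Definition zero_from n x : Prop := forall i, (n <= i)%N -> x i = false.

Definition finite_bits : set bits := [set x | exists n, zero_from n x].

Lemma last_one_le x n : (last_one x n <= n)%N.
Proof. by elim: n => //= n IH; case: (x n) => //; exact: leqW. Qed.

Lemma last_one_mono x m n : (m <= n)%N -> (last_one x m <= last_one x n)%N.
Proof.
elim: n => [|n IH]; first by rewrite leqn0 => /eqP ->.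
rewrite leq_eqVlt => /orP[/eqP ->//|mn] /=; case: (x n); last exact: IH.
exact: leq_trans (last_one_le _ _) (ltnW mn).
Qed.

Lemma last_one_agree n x y : agree n x y -> last_one x n = last_one y n.
Proof.
elim: n => //= n IH xy; rewrite xy // IH // => i im.
by apply: xy; exact: leqW.
Qed.

Lemma last_one_unbounded x N : ~ finite_bits x -> exists n, (N < last_one x n)%N.
Proof.
move=> nx; have [i Ni xi] : exists2 i, (N <= i)%N & x i.
  apply: contrapT => h; apply: nx; exists N => i Ni; apply/negP => xi.
  by apply: h; exists i.
by exists i.+1; rewrite /= xi ltnS.
Qed.

Lemma code_agree n x y : agree n x y -> code x n = code y n.
Proof.
elim: n => //= n IH xy; rewrite xy // IH // => i im.
by apply: xy; exact: leqW.
Qed.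

Lemma code_lt x n : (code x n < 2 ^ n)%N.
Proof. by elim: n => //= n IH; rewrite expnS; case: (x n) => /=; lia. Qed.

Lemma code_inj x y n : code x n = code y n -> agree n x y.
Proof.
elim: n => [|n IH] //= xy.
have := code_lt x n; have := code_lt y n => yn xn.
have xyn : x n = y n by move: xy; case: (x n) (y n) => -[] //=; lia.
by apply: agreeS => //; apply: IH; move: xy; rewrite xyn => /addIn.
Qed.

Lemma last_one_stable x m n : zero_from m x -> (m <= n)%N ->
  last_one x n = last_one x m.
Proof.
move=> xm /subnK <-; elim: (n - m)%N => //= k ->.
by rewrite xm // leq_addl.
Qed.

Lemma code_stable x m n : zero_from m x -> (m <= n)%N -> code x n = code x m.
Proof.
move=> xm /subnK <-; elim: (n - m)%N => //= k ->.
by rewrite xm ?leq_addl // mul0n addn0.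
Qed.

(** Meaningful on [finite_bits] only, where every admissible bound gives the same value; elsewhere
    the value is arbitrary. *)
Definition code_lim x : nat := code x (get [set n | zero_from n x]).

Lemma code_limE x n : zero_from n x -> code_lim x = code x n.
Proof.
move=> xn; rewrite /code_lim.
have : zero_from (get [set n | zero_from n x]) x.
  by have /getPex : exists n, [set n | zero_from n x] n by exists n.
move: (get _) => m xm; have [mn|/ltnW nm] := leqP m n.
  by rewrite -(code_stable xm mn).
by rewrite -(code_stable xn nm).
Qed.

Lemma code_lim_inj x y : finite_bits x -> finite_bits y ->
  code_lim x = code_lim y -> x = y.
Proof.
move=> [m xm] [n yn].
have xk : zero_from (maxn m n) x by move=> i; rewrite geq_max => /andP[/xm].
have yk : zero_from (maxn m n) y by move=> i; rewrite geq_max => /andP[_ /yn].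
rewrite (code_limE xk) (code_limE yk) => /code_inj xy; apply/funext => i.
by have [/xy//|ki] := ltnP i (maxn m n); rewrite xk ?yk.
Qed.

Definition truncate n x : bits := fun i => (i < n)%N && x i.

Lemma truncate_agree n x : agree n x (truncate n x).
Proof. by move=> i im; rewrite /truncate im. Qed.

Lemma truncate_zero n x : zero_from n (truncate n x).
Proof. by move=> i ni; rewrite /truncate ltnNge ni. Qed.

Definition set_bit p x : bits := fun i => x i || (i == p).

Lemma set_bit_agree p x : agree p x (set_bit p x).
Proof. by move=> i ip; rewrite /set_bit (ltn_eqF ip) orbF. Qed.

Lemma set_bit_zero p x n : zero_from n x -> (n <= p)%N ->
  zero_from p.+1 (set_bit p x).
Proof.
move=> xn np i pi; rewrite /set_bit xn ?(leq_trans np (ltnW pi)) //=.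
by rewrite gtn_eqF.
Qed.

End BitStates.

(* [M h L j] is the height to which a leg of height [h] whose last nonzero bit
   is at position [L - 1] drops; [inv h L] holds along the construction, and
   [Q h L h' L'] relates a state to the later ones. *)
Record drop_rule (R : realType) (M : R -> nat -> nat -> R)
    (inv : R -> nat -> Prop) (Q : R -> nat -> R -> nat -> Prop) : Prop := {
  dr_inv0 : inv 1 0;
  dr_inv_skip : forall h L p, (L <= p)%N -> inv h L -> inv h p.+1;
  dr_inv_loss : forall h L j p, (L <= p)%N -> (j <= p - L)%N ->
    inv h L -> inv (M h L j) p.+1;
  dr_inv_bound : forall h L, inv h L -> 0 < h <= 1;
  dr_inv_M : forall h L j, inv h L -> 0 < M h L j < h;
  dr_M_inj : forall h L, inv h L -> injective (M h L);
  dr_Q_refl : forall h L, inv h L -> Q h L h L;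
  dr_Q_skip : forall h L h' L' p, (L' <= p)%N -> Q h L h' L' -> Q h L h' p.+1;
  dr_Q_loss : forall h L h' L' j p, (L' <= p)%N ->
    inv h' L' -> Q h L h' L' -> Q h L (M h' L' j) p.+1;
  dr_Q_near : forall h L h' L', inv h' L' -> Q h L h' L' ->
    h - 2^-1 ^+ L <= h' \/ h' <= 2^-1 ^+ L }.

(** * Heights and their marks for a general drop rule *)

Section Heights.
Variables (R : realType) (lossy : nat -> bool) (M : R -> nat -> nat -> R).
Variable (a : nat -> nat).

(** Halving the distance to the last one gives two consecutive positions the same drop index, so it
    is enough that one position of each such pair is lossy. The reduction modulo [a] leaves as many
    drop values over a word as marks are wanted. *)
Fixpoint hgt (x : bits) n : R :=
  if n is n'.+1 then
    (if x n' && lossy n' then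
       M (hgt x n') (last_one x n')
         (((n' - last_one x n')./2 %% a (code x n'))%N)
     else hgt x n')
  else 1.

Definition limit_height (x : bits) : R := inf (range (hgt x)).

Lemma hgt_agree n x y : agree n x y -> hgt x n = hgt y n.
Proof.
elim: n => //= n IH xy.
have xy' : agree n x y by move=> i im; apply: xy; exact: leqW.
by rewrite xy // IH // (last_one_agree xy') (code_agree xy').
Qed.

Lemma hgt_stable x m n : zero_from m x -> (m <= n)%N -> hgt x n = hgt x m.
Proof.
move=> xm /subnK <-; elim: (n - m)%N => //= k ->.
by rewrite xm // leq_addl.
Qed.

Local Notation d n := (2^-1 ^+ n : R).

Lemma d_gt0 n : 0 < d n. Proof. by rewrite exprn_gt0 // invr_gt0. Qed.

Lemma d_le m n : (m <= n)%N -> d n <= d m.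
Proof. by move=> mn; apply: ler_wiXn2l => //; lra. Qed.

Lemma dS n : d n.+1 = d n / 2. Proof. by rewrite exprSr. Qed.

Lemma d_inj m n : d m = d n -> m = n.
Proof.
have h i j : (i < j)%N -> d j < d i.
  move=> ij; apply: le_lt_trans (d_le ij) _; rewrite dS.
  by have := d_gt0 i; lra.
move=> e; case: (ltngtP m n) => // /h; rewrite e ltxx //.
Qed.

Lemma d_small e : 0 < e -> exists n, d n < e.
Proof.
move=> e0; have : (fun n => d n) @ \oo --> (0 : R).
  by apply: cvg_expr; rewrite ger0_norm; lra.
move/cvgr0Pnorm_lt => /(_ e e0)[n _ /(_ n) /= H].
by exists n; apply: le_lt_trans (H _) => //; exact: ler_norm.
Qed.

Variables (inv : R -> nat -> Prop) (Q : R -> nat -> R -> nat -> Prop).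
Hypothesis rule : drop_rule M inv Q.
Let inv0 := dr_inv0 rule.
Let inv_skip := dr_inv_skip rule.
Let inv_loss := dr_inv_loss rule.
Let inv_bound := dr_inv_bound rule.
Let inv_M := dr_inv_M rule.
Let M_inj := dr_M_inj rule.
Let Q_refl := dr_Q_refl rule.
Let Q_skip := dr_Q_skip rule.
Let Q_loss := dr_Q_loss rule.
Let Q_near := dr_Q_near rule.
Hypothesis a_inj : injective a.
Hypothesis a_pos : forall c, (0 < a c)%N.
Hypothesis lossy_hit : forall L k j N, (j < k)%N ->
  exists p, [/\ (N <= p)%N, lossy p & ((p - L)./2 %% k)%N = j].

Implicit Types (x y : bits) (n : nat).
Let f := limit_height.

Lemma hgt_inv x n : inv (hgt x n) (last_one x n).
Proof.
elim: n => //= n IH; case: (x n) => //=.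
case: (lossy n) => /=; last exact: inv_skip (last_one_le x n) IH.
apply: inv_loss => //; first exact: last_one_le.
by apply: leq_trans (leq_mod _ _) _; lia.
Qed.

Lemma hgt_Q x n m : Q (hgt x n) (last_one x n) (hgt x (n + m)) (last_one x (n + m)).
Proof.
elim: m => [|m IH]; first by rewrite addn0; apply: Q_refl; exact: hgt_inv.
rewrite addnS /=; case: (x _) => //=.
case: (lossy _) => /=; last by apply: Q_skip IH; exact: last_one_le.
by apply: Q_loss => //; [exact: last_one_le|exact: hgt_inv].
Qed.

Lemma hgt_anti x m n : (m <= n)%N -> hgt x n <= hgt x m.
Proof.
move=> /subnK <-; elim: (n - m)%N => //= k IH.
case: ifP => // _; apply: le_trans IH; apply: ltW.
by set j := (_ %% _)%N; have /andP[] := inv_M j (hgt_inv x (k + m)).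
Qed.

Lemma limit_le x n : f x <= hgt x n.
Proof.
apply: ge_inf; last by exists n.
exists 0 => _ [m _ <-]; have := inv_bound (hgt_inv x m).
by move=> /andP[/ltW].
Qed.

Lemma limit_ge x n c : (forall m, c <= hgt x (n + m)) -> c <= f x.
Proof.
move=> H; apply: lb_le_inf; first by exists (hgt x 0), 0%N.
move=> _ [m _ <-]; apply: le_trans (H m) _; apply: hgt_anti; exact: leq_addl.
Qed.

Lemma limit_approx x e : 0 < e -> exists n, hgt x n < f x + e.
Proof.
move=> e0; apply: contrapT => /forallNP H.
have : f x + e <= f x.
  by apply: (@limit_ge x 0) => m; rewrite add0n leNgt; apply/negP/H.
by lra.
Qed.

Lemma limit_finite x n : zero_from n x -> f x = hgt x n.
Proof.
move=> xn; apply/eqP; rewrite eq_le limit_le /=; apply: (@limit_ge x n) => m.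
by rewrite (hgt_stable xn) ?leq_addr.
Qed.

(** A single later height below the bound forces the infimum below it; failing that, [dr_Q_near]
    keeps all later heights near the present one. *)
Lemma limit_near x n :
  hgt x n - d (last_one x n) <= f x \/ f x <= d (last_one x n).
Proof.
have [[m hm]|/forallNP H] :=
    pselect (exists m, hgt x (n + m) <= d (last_one x n)).
  by right; apply: le_trans hm; exact: limit_le.
left; apply: (@limit_ge x n) => m.
by have [//|h] := Q_near (hgt_inv _ _) (hgt_Q x n m); case: (H m h).
Qed.

Lemma separated_values (F : nat -> R) k t : (forall j, (j < k)%N -> F j <> t) ->
  exists2 e, 0 < e & forall j, (j < k)%N -> e <= `|t - F j|.
Proof.
elim: k => [|k IH] H; first by exists 1.
have [e e0 He] := IH (fun j jk => H j (leqW jk)).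
have tk : 0 < `|t - F k|.
  by rewrite normr_gt0 subr_eq0; apply/eqP => tF; apply: (H k).
exists (Num.min e `|t - F k|); first by rewrite lt_min e0.
move=> j; rewrite ltnS leq_eqVlt => /orP[/eqP ->|/He h].
  by rewrite ge_min lexx orbT.
by rewrite ge_min h.
Qed.

(** Setting one suitable late bit realises each drop value exactly. Conversely, a leg near [x] first
    differs from it by a late one, where its height is kept or becomes one of these values; by
    [limit_near] its final height is close to that or to [0]. *)
Lemma marks_finite x n : zero_from n x ->
  marks_at f x = M (hgt x n) (last_one x n) @` `I_(a (code x n)).
Proof.
move=> xn; have fx := limit_finite xn.
have agr p y : (n <= p)%N -> agree p x y ->
    [/\ hgt y p = hgt x n, last_one y p = last_one x n & code y p = code x n].
  move=> np xy; rewrite -(hgt_agree xy) -(last_one_agree xy) -(code_agree xy).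
  by rewrite (hgt_stable xn) // (last_one_stable xn) // (code_stable xn).
apply/seteqP; split => [t [/andP[t0 tx] H]|_ [j jk <-]]; last first.
  split; first by rewrite fx; exact: inv_M (hgt_inv x n).
  move=> m e e0; have [p [mp lp pj]] := lossy_hit (last_one x n) (maxn m n) jk.
  have np : (n <= p)%N by apply: leq_trans mp; rewrite leq_maxr.
  have fy : f (set_bit p x) = M (hgt x n) (last_one x n) j.
    rewrite (limit_finite (set_bit_zero xn np)) /=.
    have [-> -> ->] := agr _ _ np (@set_bit_agree p x).
    by rewrite /set_bit eqxx orbT lp /= pj.
  exists (set_bit p x); split.
  - apply: agree_le (@set_bit_agree p x); apply: leq_trans mp; exact: leq_maxl.
  - by rewrite fy; have /andP[] := inv_M j (hgt_inv x n).
  - by rewrite fy subrr normr0.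
apply: contrapT => nt.
have [e e0 He] : exists2 e, 0 < e & forall j, (j < a (code x n))%N ->
    e <= `|t - M (hgt x n) (last_one x n) j|.
  by apply: separated_values => j jk Mt; apply: nt; exists j.
(* This tolerance separates [t] from the drop values, from the apex and from the tip at once. *)
have e0' : 0 < Num.min (e / 2) (Num.min (t / 2) ((f x - t) / 2)).
  by rewrite !lt_min; apply/and3P; split; lra.
have [N] := d_small e0'; rewrite !lt_min => /and3P[dN1 dN2 dN3].
have [y [xy fy]] := H (maxn N n) _ e0'; rewrite !lt_min => /and3P[t1 t2 t3].
have /first_disagreement[p xyp xp] : x <> y.
  by move=> xy'; move: t3; rewrite -xy' ltr_norml; lra.
have Np : (maxn N n <= p)%N by rewrite leqNgt; apply/negP => /xy.
have np : (n <= p)%N by apply: leq_trans Np; rewrite leq_maxr.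
have yp : y p = true by move: xp; rewrite xn //; case: (y p).
have [hy ly cy] := agr _ _ np xyp.
have := limit_near y p.+1; have := limit_le y p.+1.
have dp : d p.+1 <= d N.
  by apply: d_le; apply: leq_trans (leqW Np); exact: leq_maxl.
have fx' : hgt x n = f x by rewrite fx.
rewrite /= yp hy ly cy /=; set j := (_ %% _)%N.
have jk : (j < a (code x n))%N by rewrite ltn_mod.
have := He j jk; move: t1 t2 t3; rewrite !ltr_norml => t1 t2 t3.
rewrite ler_normr => Hj.
case: ifP => _; last by rewrite fx'; case=> *; lra.
by move=> h1 [h2|h2]; case/orP: Hj; lra.
Qed.

(** With infinitely many ones [last_one] is unbounded, so by [limit_near] the heights of legs close
    to [x] are near [f x] or [0], never near a value strictly between. *)
Lemma marks_infinite x : ~ finite_bits x -> marks_at f x = set0.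
Proof.
move=> nx; apply/seteqP; split => // t [/andP[t0 tx] H].
have e0 : 0 < Num.min (t / 2) ((f x - t) / 2) by rewrite lt_min; apply/andP; split; lra.
have [N dN] := d_small e0; have [n ln] := last_one_unbounded N nx.
have dn : d (last_one x n) <= d N by apply: d_le; exact: ltnW.
have [y [xy _]] := H n _ e0; move: dN; rewrite !lt_min => /andP[d1 d2].
rewrite !ltr_norml => /andP[t1 t2].
have := limit_near y n; have := limit_le x n.
rewrite -(hgt_agree xy) -(last_one_agree xy) => h1 [h2|h2]; lra.
Qed.

Lemma limit_marked : marked_fan f finite_bits (a \o code_lim).
Proof.
split.
- move=> x; apply: le_trans (limit_le x 0) _ => //=.
- move=> x e e0; have [n hn] := limit_approx x e0; exists n => y xy.
  by apply: le_lt_trans (limit_le y n) _; rewrite -(hgt_agree xy).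
- exists (fun=> false), (set_bit 0 (fun=> false)), (set_bit 1 (fun=> false)).
  have z0 : zero_from 0 (fun=> false) by [].
  split.
  + by move=> /(congr1 (fun x : bits => x 0%N)).
  + by move=> /(congr1 (fun x : bits => x 0%N)).
  + by move=> /(congr1 (fun x : bits => x 1%N)).
  + by exists 0%N.
  + by split; [exists 1%N|exists 2%N]; exact: set_bit_zero z0 _.
- move=> x [n xn]; rewrite (limit_finite xn).
  by have /andP[] := inv_bound (hgt_inv x n).
- move=> x [n xn]; rewrite (marks_finite xn) /= (code_limE xn).
  by apply: inj_card_eq => i j _ _ /(M_inj (hgt_inv x n)).
- by move=> x _ nx; rewrite (marks_infinite nx) II0.
- move=> x n e fx e0; have [m hm] := limit_approx x e0.
  (* The height of a truncated sequence is a stage of the infimum defining [f x], hence close to it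
     for long truncations. *)
  exists (truncate (maxn m n) x); split.
  + by exists (maxn m n); exact: truncate_zero.
  + by apply: agree_le (@truncate_agree _ x); rewrite leq_maxr.
  + rewrite (limit_finite (@truncate_zero _ x)) -(hgt_agree (@truncate_agree _ x)).
    have := limit_le x (maxn m n); have := hgt_anti x (leq_maxl m n).
    by rewrite ltr_norml => *; lra.
- by move=> x y Sx Sy /a_inj/(code_lim_inj Sx Sy).
- by move=> x _; exact: a_pos.
Qed.

End Heights.

(** * Cylinders in the Cantor space and binary digits of naturals *)

Lemma cantor_nbhs_agree (u : cantor_space) (A : set cantor_space) :
  nbhs u A -> exists n, [set y | agree n u y] `<=` A.
Proof.
move=> uA; apply: contrapT => /forallNP H.
(* Points outside [A] that agree with [u] ever longer would converge to [u] coordinatewise, against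
   [A] being a neighbourhood. *)
have /choice[g gP] n : exists y : cantor_space, agree n u y /\ ~ A y.
  apply: contrapT => /forallNP h; apply: (H n) => y uy.
  by apply: contrapT => Ay; apply: (h y).
have gu : g @ \oo --> u.
  apply/cvg_sup => N U [V] [[W] oW <-] WfN WU.
  apply: (filterS WU); rewrite nbhs_simpl; exists N.+1 => // i /= Ni.
  by have [/(_ N Ni) <- _] := gP i.
have [N _ /(_ N (leqnn N)) /=] := gu _ uA.
by have [_ ] := gP N.
Qed.

Lemma nat_nbhs (c : nat) (P : set nat) : P c -> nbhs c P.
Proof. by move=> Pc; rewrite nbhs_principalE; apply/principal_filterP. Qed.

Definition bit (c i : nat) : bool := odd (c %/ 2 ^ i).

Lemma bit_zero c : zero_from c (bit c).
Proof.
move=> i ci; rewrite /bit divn_small //.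
by apply: leq_ltn_trans ci _; exact: ltn_expl.
Qed.

Lemma code_bit c n : code (bit c) n = (c %% 2 ^ n)%N.
Proof.
elim: n => [|n IH] /=; first by rewrite modn1.
rewrite IH /bit; set q := (c %/ 2 ^ n)%N; set m := (2 ^ n)%N.
have m0 : (0 < m)%N by rewrite expn_gt0.
rewrite {2}(divn_eq c m) -/q {2}(divn_eq q 2) modn2 divn2.
have -> : ((q./2 * 2 + odd q) * m + c %% m = q./2 * (2 ^ n.+1) + (c %% m + odd q * m))%N.
  by rewrite expnS -/m; lia.
rewrite modnMDl; apply/esym/modn_small; rewrite expnS -/m.
by have := ltn_pmod c m0; case: (odd q); lia.
Qed.

Lemma code_lim_bit c : code_lim (bit c) = c.
Proof.
rewrite (code_limE (@bit_zero c)) code_bit modn_small //; exact: ltn_expl.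
Qed.

Lemma bit_inj c c' : bit c = bit c' -> c = c'.
Proof. by move=> cc; rewrite -(code_lim_bit c) cc code_lim_bit. Qed.

Lemma bit_code_lim x : finite_bits x -> bit (code_lim x) = x.
Proof.
move=> Sx; apply: code_lim_inj => //; last exact: code_lim_bit.
by exists (code_lim x); exact: bit_zero.
Qed.

(** The positions [L + 2m] and [L + 2m + 1] share their drop index [m], and one of them is lossy. *)
Lemma lossy_hitP (lossy : nat -> bool) : (forall p, lossy p || lossy p.+1) ->
  forall L k j N, (j < k)%N ->
  exists p, [/\ (N <= p)%N, lossy p & ((p - L)./2 %% k)%N = j].
Proof.
(* This [m] is at least [N] and has residue [j] modulo [k]. *)
move=> H L k j N jk; pose m := (N * k + j)%N.
have Nk : (N <= N * k)%N by rewrite leq_pmulr //; lia.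
have E (e : bool) : ((L + m.*2 + e - L)./2 %% k = j)%N.
  have -> : (L + m.*2 + e - L = e + m.*2)%N by lia.
  by rewrite half_bit_double modnMDl modn_small.
case/orP: (H (L + m.*2)%N) => lp.
  exists (L + m.*2)%N; split => //; first by rewrite /m -muln2; lia.
  by have := E false; rewrite addn0.
exists (L + m.*2).+1; split => //; first by rewrite /m -muln2; lia.
by have := E true; rewrite addn1.
Qed.

(** * Families indexed by the reals *)

Section Families.
Variable R : realType.
Implicit Types x y : bits.

(** The Dedekind cut of [r], with the rationals numbered by [pickle]; numbers that code no rational
    are left out. *)
Definition cut (r : R) (c : nat) : bool :=
  if unpickle c is Some q then ratr (q : rat) < r else false.

Lemma cut_inj r r' : r <> r' -> exists c, cut r c <> cut r' c.
Proof.
have main s s' : s < s' -> exists c, cut s c <> cut s' c.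
  move=> /rat_in_itvoo[q]; rewrite in_itv /= => /andP[sq qs].
  by exists (pickle q); rewrite /cut pickleK qs (le_gtF (ltW sq)).
move=> /eqP; rewrite neq_lt => /orP[/main //|/main[c cc]].
by exists c; exact: nesym.
Qed.

Definition count (r : R) (c : nat) : nat := (c.*2 + cut r c).+1.

Lemma count_eq r r' c c' : count r c = count r' c' -> c = c' /\ cut r c = cut r' c'.
Proof.
move=> [e]; have ob s d : odd (d.*2 + cut s d) = cut s d.
  by rewrite oddD odd_double oddb.
have cc : cut r c = cut r' c' by rewrite -ob e ob.
split=> //; move: e; rewrite cc => /addIn /(congr1 half).
by rewrite !doubleK.
Qed.

(** A homeomorphism preserves counts, and a count reveals both [c] and whether [c] is in the cut, so
    homeomorphic fans have equal cuts. *)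
Lemma rigid_family (f : R -> bits -> R) :
  (forall r, marked_fan (f r) finite_bits (count r \o code_lim)) ->
  rigid_fan_family (fun r => fan (f r) : metricType R).
Proof.
move=> mf; split=> [r|r r' rr' [h hh]].
  split; last exact: marked_fan_rigid (mf r).
  have [x [y [_ [xy _ _ Sx [Sy _]]]]] := mf_three (mf r).
  exact: (fan_smooth (mf_le1 (mf r)) (mf_usc (mf r)) xy
    (mf_gt0 (mf r) Sx) (mf_gt0 (mf r) Sy)).
have [c cc] := cut_inj rr'.
have Sc : finite_bits (bit c) by exists c; exact: bit_zero.
have [y [Sy /= + _]] := homeo_special (mf r) (mf r') hh Sc.
by rewrite code_lim_bit => /count_eq[cy]; rewrite -cy; exact: cc.
Qed.

(** The last two hypotheses say that the topology of [T] is the one of the tips: agreement of bits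
    together with closeness of heights. *)
Lemma tips_homeomorphic (f : bits -> R) S a (T : topologicalType)
    (phi : T -> bits) : marked_fan f S a ->
  injective phi -> (forall t, 0 < f (phi t)) ->
  (forall x, 0 < f x -> exists t, phi t = x) ->
  (forall t n e, 0 < e ->
    nbhs t [set s | agree n (phi t) (phi s) /\ `|f (phi t) - f (phi s)| < e]) ->
  (forall t U, nbhs t U -> exists n e, 0 < e /\ forall s, agree n (phi t) (phi s) ->
    `|f (phi t) - f (phi s)| < e -> U s) ->
  homeomorphic (set_type (endpoints R (fan f))) T.
Proof.
move=> mf phi_inj fphi surj fwd bwd.
pose tip t := leg f (phi t) (f (phi t)).
have tipI t : 0 < f (phi t) <= f (phi t) by rewrite lexx fphi.
have tipP t : endpoints R (fan f) (tip t).
  by apply/(endpoint_tip mf); exists (phi t).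
have gP (e : set_type (endpoints R (fan f))) : exists t, tip t = set_val e.
  have /(endpoint_tip mf)[x fx ->] : endpoints R (fan f) (set_val e) := set_valP e.
  by have [t tx] := surj x fx; exists t; rewrite /tip tx.
have [g gE] := choice gP.
exists g, (fun t => to_set_type (tipP t)); split.
- by move=> e; apply: val_inj; exact: gE.
- move=> t; have := gE (to_set_type (tipP t)).
  by move=> /(leg_inj (tipI _) (tipI _))[/phi_inj].
- move=> e U /bwd[n [d [d0 H]]].
  pose B := [set z | exists y s, [/\ agree n (phi (g e)) y,
    `|f (phi (g e)) - s| < d, 0 < s <= f y & z = leg f y s]].
  have eB : nbhs (set_val e) B by have := nbhs_leg n (tipI (g e)) d0; rewrite -/(tip (g e)) gE.
  have neB : nbhs e (set_val @^-1` B) := @set_val_continuous _ _ e _ eB.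
  suff : nbhs e [set e' | U (g e')] by [].
  apply: filterS neB => e' [y [s [xy xs sy]]].
  rewrite -gE => /(leg_inj (tipI _) sy)[yE sE].
  by apply: H; [rewrite yE|rewrite sE].
- apply: continuous_set_val => t U tU.
  have fI s : 0 <= f (phi s) <= f (phi s) by rewrite lexx ltW.
  have [n [d [d0 H]]] := leg_nbhs (mf_le1 mf) (fI t) tU.
  suff : nbhs t [set s | U (tip s)] by [].
  by apply: filterS (fwd t n d d0) => s [ps fs]; exact: H.
Qed.

(** * Heights that drop towards zero *)

Section Shrinking.
Variables (lossy : nat -> bool).
Hypothesis lossy2 : forall p, lossy p || lossy p.+1.

Local Notation d n := (2^-1 ^+ n : R).

(** Because [L] grows with every nonzero bit, infinitely many drops force the height to [0]. *)
Definition drop_down (h : R) (L j : nat) : R := d (L + j).+1.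

Definition shrinking_height r := limit_height lossy drop_down (count r).

(** The lower bound [d L] guarantees that a drop really lowers the height. It survives a drop at [p]
    because the index satisfies [j <= p - L]. *)
Let inv (h : R) (L : nat) : Prop := d L <= h <= 1.

Let rule : drop_rule drop_down inv
  (fun h L h' L' => (L <= L')%N /\ (h' = h \/ h' <= d L)).
Proof.
split.
- by rewrite /inv expr0 !lexx.
- move=> h L p Lp /andP[Lh h1]; rewrite /inv h1 andbT.
  by apply: le_trans Lh; apply: d_le; exact: leqW.
- move=> h L j p Lp jp _; apply/andP; split; first by apply: d_le; lia.
  by rewrite -(expr0 (2^-1)) /drop_down; apply: d_le.
- move=> h L /andP[Lh ->]; rewrite andbT; apply: lt_le_trans Lh; exact: d_gt0.
- move=> h L j /andP[Lh h1]; rewrite /drop_down d_gt0 /=; apply: lt_le_trans Lh.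
  apply: le_lt_trans (@d_le R L.+1 _ _) _; first by rewrite ltnS leq_addr.
  by rewrite dS; have := d_gt0 R L; lra.
- by move=> h L _ i j /d_inj[/addnI].
- by move=> h L _; split; [|left].
- by move=> h L h' L' p Lp [LL ?]; split => //; lia.
- move=> h L h' L' j p Lp _ [LL _]; split; first by lia.
  by right; apply: d_le; lia.
- move=> h L h' L' _ [LL [->|?]]; [left|by right].
  by have := d_gt0 R L; lra.
Qed.

Lemma shrinking_marked r :
  marked_fan (shrinking_height r) finite_bits (count r \o code_lim).
Proof.
apply: (limit_marked rule); last exact: lossy_hitP.
  by move=> c c' /count_eq[].
by [].
Qed.

Let hinv r x n : inv (hgt lossy drop_down (count r) x n) (last_one x n).
Proof. exact: (hgt_inv _ _ rule). Qed.

Let f_le r x n : shrinking_height r x <= hgt lossy drop_down (count r) x n.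
Proof. exact: (limit_le _ _ rule). Qed.

(** By [shrinking_gt0] and [unlossy_of_gt0], satisfying this for some [n] means having a leg of
    positive height. *)
Definition unlossy_from n (x : bits) : Prop :=
  forall i, (n <= i)%N -> lossy i -> x i = false.

Lemma shrinking_unlossy r x n : unlossy_from n x ->
  shrinking_height r x = hgt lossy drop_down (count r) x n.
Proof.
move=> xn; apply/eqP; rewrite eq_le f_le /=.
have stab m : (n <= m)%N -> hgt lossy drop_down (count r) x m =
    hgt lossy drop_down (count r) x n.
  move=> /subnK <-; elim: (m - n)%N => //= k ->.
  case: ifP => // /andP[xk lk]; move: xk; rewrite xn //; exact: leq_addl.
by apply: (@limit_ge _ _ _ _ _ _ rule x n) => m; rewrite stab ?leq_addr.
Qed.

Lemma shrinking_gt0 r x n : unlossy_from n x -> 0 < shrinking_height r x.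
Proof.
move=> xn; rewrite (shrinking_unlossy r xn).
by have /andP[+ _] := hinv r x n; apply: lt_le_trans; exact: d_gt0.
Qed.

Let f_after_lossy r x p : lossy p -> x p ->
  shrinking_height r x <= d (last_one x p).+1.
Proof.
move=> lp xp; apply: le_trans (f_le r x p.+1) _.
by rewrite /= lp xp /=; apply: d_le; lia.
Qed.

(** Lossy ones occurring arbitrarily late would bring the height below every [d N]. *)
Lemma unlossy_of_gt0 r x : 0 < shrinking_height r x -> exists n, unlossy_from n x.
Proof.
move=> fx; apply: contrapT => nx.
have [N dN] := d_small fx.
have nfx : ~ finite_bits x.
  by move=> [n xn]; apply: nx; exists n => i ni _; exact: xn.
have [n Nn] := last_one_unbounded N nfx.
have [p [np lp xp]] : exists p, [/\ (n <= p)%N, lossy p & x p].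
  apply: contrapT => H; apply: nx; exists n => i ni li; apply/negP => xi.
  by apply: H; exists i.
have := f_after_lossy r lp xp; apply/negP; rewrite -ltNge; apply: le_lt_trans dN.
by apply: d_le; have := last_one_mono x np; lia.
Qed.

(** A lossy one of [y] from position [n] on would put its height at or below half of
    [d (last_one x n)], which is at most half the height over [x]. *)
Lemma shrinking_near r x y n : unlossy_from n x -> agree n x y ->
  shrinking_height r x / 2 < shrinking_height r y -> unlossy_from n y.
Proof.
move=> xn xy xyf p np lp; apply/negP => yp.
have := f_after_lossy r lp yp; apply/negP; rewrite -ltNge; apply: le_lt_trans xyf.
rewrite (shrinking_unlossy r xn); have /andP[+ _] := hinv r x n.
have : d (last_one y p).+1 <= d (last_one x n).+1.
  by apply: d_le; rewrite ltnS (last_one_agree xy); exact: last_one_mono.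
by rewrite [d (last_one x n).+1]dS; lra.
Qed.

Lemma shrinking_agree r x y n : unlossy_from n x -> unlossy_from n y ->
  agree n x y -> shrinking_height r x = shrinking_height r y.
Proof.
move=> xn yn xy; rewrite (shrinking_unlossy r xn) (shrinking_unlossy r yn).
exact: hgt_agree.
Qed.

End Shrinking.

Lemma nat_endpoints r :
  homeomorphic (set_type (endpoints R (fan (shrinking_height xpredT r)))) nat.
Proof.
have zu n x : unlossy_from xpredT n x <-> zero_from n x.
  by split=> H i ni; [|move=> _]; apply: H.
have mf : marked_fan _ _ _ := shrinking_marked (lossy := xpredT) (fun=> isT) r.
apply: (@tips_homeomorphic _ _ _ nat bit mf).
- exact: bit_inj.
- by move=> c; apply: (@shrinking_gt0 _ _ _ c); apply/zu; exact: bit_zero.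
- move=> x /unlossy_of_gt0[n /zu xn]; exists (code_lim x).
  by apply: bit_code_lim; exists n.
- by move=> c n e e0; apply: nat_nbhs; split => //; rewrite subrr normr0.
(* Agreement on [c] bits and a height above half of the given one leave a single leg, so the tip is
   isolated. *)
- move=> c U /nbhs_singleton Uc; exists c, (shrinking_height xpredT r (bit c) / 2).
  have cc : unlossy_from xpredT c (bit c) by apply/zu; exact: bit_zero.
  have fc := shrinking_gt0 r cc; split; first by lra.
  move=> c' ac; rewrite ltr_norml => /andP[h1 h2].
  have /(shrinking_near cc ac)/zu c'c : shrinking_height xpredT r (bit c) / 2 <
    shrinking_height xpredT r (bit c') by lra.
  suff <- : c = c' by [].
  apply: bit_inj; apply/funext => i; have [/ac //|ci] := ltnP i c.
  by rewrite c'c // bit_zero.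
Qed.

(** The lossy odd positions carry the natural number, which has finitely many digits; the even
    positions are free and carry the Cantor point. *)
Definition interleave (t : cantor_space * nat) : bits :=
  fun i => if odd i then bit t.2 i./2 else t.1 i./2.

Lemma interleave_unlossy t : unlossy_from odd t.2.*2 (interleave t).
Proof.
move=> i ti oi; rewrite /interleave oi bit_zero //.
by rewrite -[X in (X <= _)%N]doubleK half_leq.
Qed.

Lemma interleave_odd t k : interleave t k.*2.+1 = bit t.2 k.
Proof. by rewrite /interleave /= odd_double /= uphalf_double. Qed.

Lemma interleave_even t k : interleave t k.*2 = t.1 k.
Proof. by rewrite /interleave odd_double doubleK. Qed.

Lemma cantor_nat_endpoints r :
  homeomorphic (set_type (endpoints R (fan (shrinking_height odd r))))
    (cantor_space * nat)%type.
Proof.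
have odd2 p : odd p || odd p.+1 by rewrite /= orbN.
have mf := shrinking_marked odd2 r.
apply: (@tips_homeomorphic _ _ _ (cantor_space * nat)%type interleave mf).
- move=> [u c] [v c'] uv.
  congr (_, _); last first.
    apply: bit_inj; apply/funext => k.
    by rewrite -(interleave_odd (u, c)) -(interleave_odd (v, c')) uv.
  apply/funext => k.
  by have := congr1 (fun x : bits => x k.*2) uv; rewrite !interleave_even.
- by move=> t; apply: shrinking_gt0; exact: interleave_unlossy.
- move=> x /unlossy_of_gt0[n xn].
  pose w : bits := fun k => x k.*2.+1.
  have Sw : finite_bits w.
    by exists n => k nk; apply: xn; rewrite /= ?odd_double //; lia.
  exists ((fun k => x k.*2) : cantor_space, code_lim w); apply/funext => i.
  rewrite -[i in LHS]odd_double_half; case: (odd i) (odd_double_half i) => /=.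
    by rewrite add1n => {2}<-; rewrite interleave_odd /= bit_code_lim.
  by rewrite add0n => {2}<-; rewrite interleave_even.
- move=> [u c] n e e0.
  (* From [2c] on no lossy bit is set, so agreement up to [N] makes the heights equal. *)
  pose N := maxn n c.*2.
  exists ([set v : cantor_space | agree N u v], [set c]).
    split; first exact: agree_nbhs.
    exact: nat_nbhs.
  move=> [v _] /= [uv ->].
  have aN : agree N (interleave (u, c)) (interleave (v, c)).
    move=> i iN; rewrite /interleave; case: (odd i) => //=; apply: uv.
    by apply: leq_ltn_trans iN; lia.
  split; first by apply: agree_le aN; rewrite leq_maxl.
  have unl w : unlossy_from odd N (interleave (w, c)).
    by move=> i Ni; apply: interleave_unlossy; move: Ni; rewrite geq_max => /andP[].
  by rewrite (shrinking_agree r (unl u) (unl v) aN) subrr normr0.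
- move=> [u c] U [[A B] /= [/cantor_nbhs_agree[m mA] /nbhs_singleton Bc] ABU].
  pose N := maxn m.*2 c.*2.
  have unl : unlossy_from odd N (interleave (u, c)).
    by move=> i Ni; apply: interleave_unlossy; move: Ni; rewrite geq_max => /andP[].
  have fc := shrinking_gt0 r unl.
  exists N, (shrinking_height odd r (interleave (u, c)) / 2); split; first by lra.
  move=> [v c'] aN; rewrite ltr_norml => /andP[h1 h2].
  have /(shrinking_near unl aN) vc' : shrinking_height odd r (interleave (u, c)) / 2 <
    shrinking_height odd r (interleave (v, c')) by lra.
  have <- : c = c'.
    apply: bit_inj; apply/funext => k.
    rewrite -(interleave_odd (u, c)) -(interleave_odd (v, c')).
    have [/aN //|Nk] := ltnP k.*2.+1 N.
    by rewrite unl ?vc' //= odd_double.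
  apply: ABU; split => //; apply: mA => k km.
  rewrite -[LHS](interleave_even (u, c)) -[RHS](interleave_even (v, c')); apply: aN.
  by rewrite /N leq_max; apply/orP; left; lia.
Qed.

End Families.

(** * Nested pieces of the irrational numbers *)

Section DyadicPieces.
Variable F : realFieldType.
Implicit Types a q b : F.

(** Even pieces lie below the pivot and accumulate at [a], odd ones lie above it and accumulate at
    [b]. Thus every child stays away from the ends of its parent, which keeps limits of nested
    pieces inside the open intervals, while the pivot becomes an end of pieces and is removed. *)
Definition piece_lo a q b n : F :=
  if odd n then b - (b - q) * 2^-1 ^+ n./2 else a + (q - a) * 2^-1 ^+ n./2.+1.

Definition piece_hi a q b n : F :=
  if odd n then b - (b - q) * 2^-1 ^+ n./2.+1 else a + (q - a) * 2^-1 ^+ n./2.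

Let d_itv n : 0 < (2^-1 : F) ^+ n <= 1.
Proof. by rewrite exprn_gt0 ?invr_gt0 //= exprn_ile1 //; lra. Qed.

Lemma piece_itv a q b n : a < q -> q < b ->
  [/\ a < piece_lo a q b n, piece_hi a q b n < b,
      piece_lo a q b n < piece_hi a q b n,
      piece_hi a q b n - piece_lo a q b n <= (b - a) / 2 &
      if odd n then q <= piece_lo a q b n else piece_hi a q b n <= q].
Proof.
move=> aq qb; rewrite /piece_lo /piece_hi; have /andP[d0 d1] := d_itv n./2.
by case: (odd n); rewrite exprSr; split; nra.
Qed.

Lemma piece_uniq a q b m n z : a < q -> q < b ->
  piece_lo a q b m < z < piece_hi a q b m ->
  piece_lo a q b n < z < piece_hi a q b n -> m = n.
Proof.
move=> aq qb zm zn.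
have e : odd m = odd n.
  have [_ _ _ _] := piece_itv m aq qb; have [_ _ _ _] := piece_itv n aq qb.
  by move: zm zn; case: (odd m) (odd n) => -[] //; lra.
have main i j c (s : F) : 0 < c -> c * 2^-1 ^+ i.+1 < s < c * 2^-1 ^+ i ->
    c * 2^-1 ^+ j.+1 < s < c * 2^-1 ^+ j -> (i <= j)%N.
  move=> c0 /andP[_ si] /andP[sj _]; rewrite leqNgt; apply/negP => ji.
  suff : c * 2^-1 ^+ i <= c * 2^-1 ^+ j.+1 by lra.
  by apply: ler_wpM2l; [exact: ltW|apply: ler_wiXn2l => //; lra].
have main2 i j c (s : F) : 0 < c -> c * 2^-1 ^+ i.+1 < s < c * 2^-1 ^+ i ->
    c * 2^-1 ^+ j.+1 < s < c * 2^-1 ^+ j -> i = j.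
  by move=> c0 hi hj; apply/eqP; rewrite eqn_leq (main i j c s) // (main j i c s).
have ha : 0 < q - a by lra.
have hb : 0 < b - q by lra.
suff h : m./2 = n./2 by rewrite -(odd_double_half m) -(odd_double_half n) e h.
move: zm zn; rewrite /piece_lo /piece_hi e; case: (odd n) => /andP[? ?] /andP[? ?].
  by apply: (main2 _ _ _ (b - z) hb); apply/andP; split; lra.
by apply: (main2 _ _ _ (z - a) ha); apply/andP; split; lra.
Qed.

End DyadicPieces.

Lemma dyadic_scale (R : realType) (c s : R) : 0 < s -> s <= c ->
  exists i, c * 2^-1 ^+ i.+1 < s <= c * 2^-1 ^+ i.
Proof.
move=> s0 sc; have c0 : 0 < c by lra.
have [n dn] : exists n, 2^-1 ^+ n < s / c by apply: d_small; rewrite divr_gt0.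
have ex : exists n, c * 2^-1 ^+ n < s.
  by exists n; move: dn; rewrite ltr_pdivlMr // mulrC.
case: (ex_minnP ex) => -[|i] hi imin; first by move: hi; rewrite expr0 mulr1; lra.
exists i; rewrite hi /= leNgt; apply/negP => /imin; by rewrite ltnn.
Qed.

Lemma piece_cover (R : realType) (a q b z : R) : a < q -> q < b -> a < z < b ->
  z <> q -> (forall n, z <> piece_lo a q b n /\ z <> piece_hi a q b n) ->
  exists n, piece_lo a q b n < z < piece_hi a q b n.
Proof.
move=> aq qb /andP[az zb] /eqP zq zn.
have [zq'|qz] : z < q \/ q < z by apply/orP; rewrite -neq_lt.
  have [i /andP[h1 h2]] : exists i, (q - a) * 2^-1 ^+ i.+1 < z - a <= (q - a) * 2^-1 ^+ i.
    by apply: dyadic_scale; lra.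
  exists i.*2; have [_ /eqP] := zn i.*2; rewrite /piece_lo /piece_hi odd_double doubleK.
  by move=> ne; apply/andP; split; [lra|rewrite lt_neqAle ne /=; lra].
have [i /andP[h1 h2]] : exists i, (b - q) * 2^-1 ^+ i.+1 < b - z <= (b - q) * 2^-1 ^+ i.
  by apply: dyadic_scale; lra.
exists i.*2.+1; have [/eqP + _] := zn i.*2.+1.
rewrite /piece_lo /piece_hi /= odd_double /= uphalf_double => ne.
by apply/andP; split; last lra; rewrite lt_neqAle eq_sym ne /=; lra.
Qed.

(** * A scheme for the irrational numbers *)

Section IrrationalScheme.
Variable R : realType.

Local Notation irr := (set_type (@irrational R)).

Definition rat_node := option (rat * rat * nat).

(** The rational numbered [l] is removed at level [l] if it lies in the interval; otherwise the
    midpoint keeps the subdivision going. *)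
Definition pivot (a b : rat) (l : nat) : rat :=
  if unpickle l is Some q then (if a < q < b then q else (a + b) / 2)
  else (a + b) / 2.

Definition rat_child (v : rat_node) (n : nat) : rat_node :=
  if v is Some (a, b, l) then
    Some (piece_lo a (pivot a b l) b n, piece_hi a (pivot a b l) b n, l.+1)
  else if odd n then Some (n./2%:R, n./2.+1%:R, 0%N)
  else Some (- n./2.+1%:R, - n./2%:R, 0%N).

Definition rat_part (v : rat_node) : set irr :=
  if v is Some (a, b, l) then [set z | ratr a < \val z < ratr b] else setT.

Lemma irr_neq (z : irr) (q : rat) : \val z <> ratr q.
Proof. by move=> zq; apply: (set_valP z); exists q. Qed.

Lemma pivot_itv a b l : a < b -> a < pivot a b l < b.
Proof.
have m : a < b -> a < (a + b) / 2 < b by move=> ?; apply/andP; split; lra.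
rewrite /pivot; case: (unpickle l) => [q|]; last exact: m.
by case: ifP => // _; exact: m.
Qed.

Lemma pivot_pickle a b q : a < q < b -> pivot a b (pickle q) = q.
Proof. by move=> h; rewrite /pivot pickleK h. Qed.

Lemma ratr_piece_lo a q b n :
  ratr (piece_lo a q b n) = piece_lo (ratr a) (ratr q) (ratr b) n :> R.
Proof.
by rewrite /piece_lo; case: ifP => _;
  rewrite !(rmorphB, rmorphD, rmorphM, rmorphXn, fmorphV, rmorph1).
Qed.

Lemma ratr_piece_hi a q b n :
  ratr (piece_hi a q b n) = piece_hi (ratr a) (ratr q) (ratr b) n :> R.
Proof.
by rewrite /piece_hi; case: ifP => _;
  rewrite !(rmorphB, rmorphD, rmorphM, rmorphXn, fmorphV, rmorph1).
Qed.

Lemma rat_walk al k : exists a b,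
  [/\ walk None rat_child al k.+1 = Some (a, b, k), a < b &
      b - a <= 2^-1 ^+ k].
Proof.
elim: k => [|k [a [b [wk ab dab]]]].
  rewrite /=; case: ifP => _.
    by exists (al 0%N)./2%:R, (al 0%N)./2.+1%:R; rewrite ltr_nat; split; rewrite // -natr1; lra.
  exists (- (al 0%N)./2.+1%:R), (- (al 0%N)./2%:R); rewrite ltrN2 ltr_nat.
  by split; rewrite // -natr1; lra.
rewrite [walk _ _ _ _]/= -/(walk _ _ _ k.+1) wk /=.
have /andP[aq qb] := pivot_itv k ab.
have [_ _ ? h _] := piece_itv (al k.+1) aq qb.
do 2 eexists; split; first reflexivity; first by [].
by apply: le_trans h _; rewrite exprSr ler_wpM2r.
Qed.

Lemma rat_walk_step al k a b : walk None rat_child al k.+1 = Some (a, b, k) ->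
  walk None rat_child al k.+2 = Some (piece_lo a (pivot a b k) b (al k.+1),
    piece_hi a (pivot a b k) b (al k.+1), k.+1).
Proof. by move=> wk; rewrite [walk _ _ _ _]/= -/(walk _ _ _ k.+1) wk. Qed.

Lemma open_rat_part v : open (rat_part v).
Proof.
case: v => [[[a b] l]|]; last exact: openT.
exists (`]ratr a, ratr b[%classic : set R); first exact: interval_open.
by apply/seteqP; split => z /=; rewrite in_itv.
Qed.

Lemma nat_between (z : R) : 0 < z -> exists n, n%:R <= z < n.+1%:R.
Proof.
move=> z0; have ex : exists n, z < n%:R.
  by exists (Num.bound z); apply: archi_boundP; exact: ltW.
case: (ex_minnP ex) => -[|n] zn nmin; first by move: zn; rewrite ltNge ltW.
by exists n; rewrite zn andbT leNgt; apply/negP => /nmin; rewrite ltnn.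
Qed.

Lemma irrational_scheme : scheme None rat_child rat_part.
Proof.
split => //.
- move=> al k v; split; first exact: open_rat_part.
  + rewrite /v; case: k v => [|k] v.
      move=> z _ /=; have /eqP := @irr_neq z 0; rewrite rmorph0 neq_lt => /orP[z0|z0].
        have [n /andP[n1 n2]] : exists n, n%:R <= - \val z < n.+1%:R.
          by apply: nat_between; rewrite oppr_gt0.
        have nz : - \val z != n%:R.
          by apply/eqP => h; apply: (@irr_neq z (- n%:R)); rewrite rmorphN /= ratr_nat -h opprK.
        exists n.*2 => //; rewrite /= odd_double doubleK /= !rmorphN /= !ratr_nat.
        have n3 : n%:R < - \val z by rewrite lt_neqAle eq_sym nz.
        by move: n2 n3 => /= n2 n3; apply/andP; split; lra.
      have [n /andP[n1 n2]] := nat_between z0.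
      exists n.*2.+1 => //; rewrite /= odd_double /= uphalf_double /= !ratr_nat n2 andbT.
      rewrite lt_neqAle n1 andbT eq_sym; apply/eqP => h.
      by apply: (@irr_neq z n%:R); rewrite ratr_nat.
    have [a [b [-> ab _]]] := rat_walk al k; have /andP[aq qb] := pivot_itv k ab.
    move=> z /= zab.
    have [n hn] : exists n, piece_lo (ratr a) (ratr (pivot a b k)) (ratr b) n < \val z
        < piece_hi (ratr a) (ratr (pivot a b k)) (ratr b) n.
      apply: piece_cover => //; rewrite ?ltr_rat //; first exact: irr_neq.
      by move=> n; rewrite -ratr_piece_lo -ratr_piece_hi; split; exact: irr_neq.
    by exists n => //=; rewrite ratr_piece_lo ratr_piece_hi.
  + move=> n z; rewrite /v; case: k v => [//|k] v.
    have [a [b [-> ab _]]] := rat_walk al k; have /andP[aq qb] := pivot_itv k ab.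
    have [h1 h2 _ _ _] := piece_itv n aq qb.
    move: h1 h2; rewrite -!(ltr_rat R) /= => h1 h2 /andP[z1 z2].
    by rewrite (lt_trans h1) // (lt_trans z2).
  + move=> m n z; rewrite /v; case: k v => [|k] v.
      have nd i j (y : R) : i%:R < y < i.+1%:R -> j%:R < y < j.+1%:R -> i = j.
        move=> /andP[i1 i2] /andP[j1 j2]; apply/eqP; rewrite eqn_leq.
        by apply/andP; split; rewrite -ltnS -(ltr_nat R); [apply: lt_trans i1 _|apply: lt_trans j1 _].
      rewrite /= => zm zn.
      have e : odd m = odd n.
        move: zm zn; case: (odd m) (odd n) => -[] //=;
          rewrite !rmorphN /= !ratr_nat => /andP[h1 h2] /andP[h3 h4].
          by have := ler0n R m./2; have := ler0n R n./2; lra.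
        by have := ler0n R m./2; have := ler0n R n./2; lra.
      rewrite -(odd_double_half m) -(odd_double_half n) e; congr (_ + _.*2)%N.
      move: zm zn; rewrite e; case: (odd n) => /=; rewrite ?rmorphN /= !ratr_nat.
        exact: nd.
      move=> /andP[h1 h2] /andP[h3 h4].
      by apply: (nd _ _ (- sval z)); apply/andP; split; lra.
    have [a [b [-> ab _]]] := rat_walk al k; have /andP[aq qb] := pivot_itv k ab.
    move: aq qb; rewrite /= !ratr_piece_lo !ratr_piece_hi -!(ltr_rat R).
    exact: piece_uniq.
- move=> al x U xal xU; case: xU => _ [[V oV <-] Vx VU].
  have /nbhs_ballP[e /= e0 eV] : nbhs (\val x) V by apply: open_nbhs_nbhs.
  have [k dk] := d_small e0; exists k.+1 => y.
  have := xal k.+1; have [a [b [-> ab dab]]] := rat_walk al k => /= xab yab.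
  apply: VU; apply: eV; rewrite /ball /=.
  have : ratr b - ratr a <= 2^-1 ^+ k :> R.
    by move: dab; rewrite -(ler_rat R) !(rmorphB, rmorphXn, fmorphV, rmorphD, rmorph1).
  by move: xab yab => /andP[? ?] /andP[? ?] ?; rewrite ltr_norml set_valE /=; apply/andP; split; lra.
- move=> al.
  have /choice[ab abP] k : exists p : rat * rat,
      walk None rat_child al k.+1 = Some (p.1, p.2, k) /\ p.1 < p.2.
    by have [a [b [wk h _]]] := rat_walk al k; exists (a, b).
  pose A k : R := ratr (ab k).1; pose B k : R := ratr (ab k).2.
  have AB k : A k < B k by rewrite ltr_rat; case: (abP k).
  have stepP k : let q := pivot (ab k).1 (ab k).2 k in
      [/\ A k < A k.+1, B k.+1 < B k & ratr q <= A k.+1 \/ B k.+1 <= ratr q].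
    move=> q; have [wk h] := abP k; have /andP[aq qb] := pivot_itv k h.
    have := rat_walk_step wk; have [-> _] := abP k.+1; move=> [e1 e2].
    have [h1 h2 _ _] := piece_itv (al k.+1) aq qb.
    rewrite /A /B e1 e2 !ltr_rat !ler_rat; split => //.
    by move: p; case: (odd _); [left|right].
  have Amono m n : (m <= n)%N -> A m <= A n.
    move=> /subnK <-; elim: (n - m)%N => //= i; rewrite addSn => IH.
    by apply: le_trans IH _; have [/ltW] := stepP (i + m)%N.
  have Bmono m n : (m <= n)%N -> B n <= B m.
    move=> /subnK <-; elim: (n - m)%N => //= i; rewrite addSn => IH.
    by apply: le_trans IH; have [_ /ltW] := stepP (i + m)%N.
  have ABk m n : A m <= B n.
    apply: le_trans (Amono m (maxn m n) (leq_maxl _ _)) _.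
    by apply: le_trans (Bmono n (maxn m n) (leq_maxr _ _)); exact/ltW/AB.
  (* Left ends strictly increase and right ends strictly decrease, so this supremum is interior to
     every interval. *)
  pose x := sup (range A).
  have xA k : A k < x.
    have [h _ _] := stepP k; apply: lt_le_trans h _.
    by apply: ub_le_sup; [exists (B 0%N) => _ [m _ <-]|exists k.+1].
  have xB k : x < B k.
    have [_ h _] := stepP k; apply: le_lt_trans h.
    by apply: ge_sup => [|_ [m _ <-] //]; exists (A 0%N), 0%N.
  have ix : irrational x.
    move=> [q _ /esym qx].
    (* A rational limit [q] would be interior at level [pickle q], hence the pivot there, and the
       next interval would leave it outside or at an end. *)
    have qk : (ab (pickle q)).1 < q < (ab (pickle q)).2.
      by rewrite -!(ltr_rat R) -qx; apply/andP; split; [exact: xA|exact: xB].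
    have [_ _] := stepP (pickle q); rewrite pivot_pickle // -qx.
    by have := xA (pickle q).+1; have := xB (pickle q).+1; move=> h1 h2 []; lra.
  exists (to_set_type ix) => -[//|k].
  by have [-> _] := abP k; rewrite /=; apply/andP; split; [exact: xA|exact: xB].
Qed.

End IrrationalScheme.

(** * A fan whose tips are irrational *)

(** Turns a scheme on the tips into statements about bit sequences and heights; as all heights are
    positive, every sequence has a tip. *)
Lemma tip_scheme (R : realType) (f : bits -> R) S a (N : Type) (root : N)
    (child : N -> nat -> N) (P : N -> set bits) : marked_fan f S a ->
  (forall x, 0 < f x) -> P root = setT ->
  (forall al k, let v := walk root child al k in
    [/\ forall x, P v x -> exists n e, 0 < e /\
          forall y, agree n x y -> `|f x - f y| < e -> P v y,
        P v `<=` \bigcup_n P (child v n),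
        forall n, P (child v n) `<=` P v &
        forall m n x, P (child v m) x -> P (child v n) x -> m = n]) ->
  (forall al x n e, 0 < e -> (forall k, P (walk root child al k) x) ->
    exists k, forall y, P (walk root child al k) y ->
      agree n x y /\ `|f x - f y| < e) ->
  (forall al, exists x, forall k, P (walk root child al k) x) ->
  scheme root child (fun v => [set e : set_type (endpoints R (fan f)) |
    exists2 x, P v x & set_val e = leg f x (f x)]).
Proof.
move=> mf f0 P0 PS Psh Pc.
have tipI x : 0 < f x <= f x by rewrite lexx f0.
have tip_inj x y : leg f x (f x) = leg f y (f y) -> x = y.
  by move=> /(leg_inj (tipI x) (tipI y))[].
have eP (e : set_type (endpoints R (fan f))) : exists x, set_val e = leg f x (f x).
  have /(endpoint_tip mf)[x _ ->] : endpoints R (fan f) (set_val e) := set_valP e.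
  by exists x.
split.
- apply/seteqP; split => // e _; have [x ex] := eP e.
  by exists x; rewrite // P0.
- move=> al k v; have [Po Pcov Psub Pdis] := PS al k; split.
  + rewrite openE => e [x Px ex] /=.
    have [n [d [d0 H]]] := Po x Px.
    pose B := [set z | exists y s, [/\ agree n x y,
      `|f x - s| < d, 0 < s <= f y & z = leg f y s]].
    have eB : nbhs (set_val e) B by rewrite ex; exact: nbhs_leg.
    have neB : nbhs e (set_val @^-1` B) := @set_val_continuous _ _ e _ eB.
    apply: filterS neB => e' [y [s [xy xs sy e's]]].
    have [u e'u] := eP e'; exists u => //.
    have [uy fu] := leg_inj (tipI u) sy (etrans (esym e'u) e's).
    by apply: H; [rewrite uy|rewrite fu].
  + move=> e [x /Pcov[n _ Pn] ex]; exists n => //; by exists x.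
  + by move=> n e [x /Psub Px ex]; exists x.
  + move=> m n e [x Px ex] [y Py ey].
    by apply: (Pdis m n x Px); rewrite (tip_inj x y) // -ex -ey.
- move=> al e U eal eU; have [x ex] := eP e.
  have xal k : P (walk root child al k) x.
    by have [y Py ey] := eal k; rewrite (tip_inj x y) // -ex -ey.
  have fI : 0 <= f x <= f x by rewrite lexx ltW.
  case: eU => _ [[V oV <-] Vx VU].
  have xV : nbhs (leg f x (f x)) V by rewrite -ex; apply: open_nbhs_nbhs.
  have [n [d [d0 H]]] := leg_nbhs (mf_le1 mf) fI xV.
  have [k kH] := Psh al x n d d0 xal; exists k => e' [y Py e'y].
  have [xy fxy] := kH y Py.
  by apply: VU; rewrite /= e'y; apply: H => //; rewrite lexx ltW.
- move=> al; have [x xal] := Pc al.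
  have tx : endpoints R (fan f) (leg f x (f x)).
    by apply/(endpoint_tip mf); exists x.
  by exists (to_set_type tx) => k; exists x.
Qed.

(** * Heights bounded away from zero *)

Section GentleDrops.
Variable R : realType.
Implicit Types x y : bits.

Local Notation d n := (2^-1 ^+ n : R).

Definition gentle_drop (h : R) (L j : nat) : R := h - d (L + j).+2.

(** The quantity [h - d L.+1] bounds all later heights from below and never decreases: a drop costs
    at most [d L.+2], and at most [d L.+2] is left for the future. It starts at one half. *)
Let inv (h : R) (L : nat) : Prop := 2^-1 + d L.+1 <= h <= 1.

Let rule : drop_rule gentle_drop inv
  (fun h L h' L' => h - d L.+1 <= h' - d L'.+1).
Proof.
have dd m n : (m <= n)%N -> d n <= d m by exact: d_le.
have d1 : d 1 = 2^-1 by rewrite expr1.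
split.
- by rewrite /inv d1 lexx andbT; lra.
- move=> h L p Lp; rewrite /inv => /andP[h0 ->]; rewrite andbT.
  by have := dd L.+1 p.+2 (leqW Lp); lra.
- move=> h L j p Lp jp /andP[h0 h1]; rewrite /inv /gentle_drop.
  have := dd L.+2 (L + j).+2; have := dd L.+2 p.+2; have := d_gt0 R (L + j).+2.
  rewrite !ltnS leq_addr => h2 /(_ Lp) h3 /(_ isT); move: h3.
  by rewrite [d L.+2]dS => h3 h4; apply/andP; split; lra.
- by move=> h L /andP[h0 ->]; rewrite andbT; have := d_gt0 R L.+1; lra.
- move=> h L j /andP[h0 h1]; rewrite /gentle_drop.
  have := d_gt0 R (L + j).+2; have := dd 1%N (L + j).+2 isT; have := d_gt0 R L.+1.
  by rewrite d1 => *; apply/andP; split; lra.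
- by move=> h L _ i j /addrI/oppr_inj/d_inj[/addnI].
- by [].
- move=> h L h' L' p Lp h0; apply: le_trans h0 _; rewrite lerD2l lerN2.
  by apply: dd; rewrite ltnS; exact: leqW.
- move=> h L h' L' j p Lp _ h0; apply: le_trans h0 _; rewrite /gentle_drop.
  have := dd L'.+2 (L' + j).+2; have := dd L'.+2 p.+2.
  rewrite !ltnS leq_addr => /(_ Lp) + /(_ isT); rewrite [d L'.+2]dS; lra.
- move=> h L h' L' _ h0; left; move: h0; rewrite !dS.
  by have := d_gt0 R L; have := d_gt0 R L'; lra.
Qed.

Variable r : R.

Let H := hgt odd gentle_drop (count r).

Definition gentle_height := limit_height odd gentle_drop (count r).

Let f := gentle_height.

Lemma gentle_marked : marked_fan f finite_bits (count r \o code_lim).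
Proof.
apply: (limit_marked rule); first by move=> c c' /count_eq[].
  by [].
by apply: lossy_hitP => p; rewrite /= orbN.
Qed.

Let Hinv x n : inv (H x n) (last_one x n).
Proof. exact: (hgt_inv _ _ rule). Qed.

Let H_agree n x y : agree n x y -> H x n = H y n.
Proof. exact: hgt_agree. Qed.

Let f_le x n : f x <= H x n.
Proof. exact: (limit_le _ _ rule). Qed.

Let f_ge x n : H x n - d (last_one x n).+1 <= f x.
Proof.
apply: (@limit_ge _ _ _ _ _ _ rule x n) => m.
have := hgt_Q odd (count r) rule x n m; rewrite -/H.
by have := d_gt0 R (last_one x (n + m)).+1; lra.
Qed.

Lemma gentle_gt0 x : 0 < f x.
Proof.
have := f_ge x 0; rewrite /H /= expr1; lra.
Qed.

(** The parity of this position decides whether the next one makes the height drop. *)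
Definition first_one m x p : Prop :=
  [/\ (m <= p)%N, x p & forall i, (m <= i < p)%N -> x i = false].

Lemma first_one_uniq m x p q : first_one m x p -> first_one m x q -> p = q.
Proof.
have h s t : first_one m x s -> first_one m x t -> (t <= s)%N.
  move=> [ms xs _] [_ _ xt]; rewrite leqNgt; apply/negP => st.
  by move: xs; rewrite xt // ms st.
by move=> hp hq; apply/eqP; rewrite eqn_leq (h _ _ hq hp) (h _ _ hp hq).
Qed.

Lemma first_oneP m x : zero_from m x \/ exists p, first_one m x p.
Proof.
have [ex|ex] := pselect (exists p, (m <= p)%N && x p).
  right; case: (ex_minnP ex) => p /andP[mp xp] pmin; exists p; split => // i.
  move=> /andP[mi ip]; apply/negP => xi; have := pmin i.
  by rewrite mi xi => /(_ isT); rewrite leqNgt ip.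
left=> i mi; apply/negP => xi; apply: ex; exists i; by rewrite mi.
Qed.

Lemma first_one_agree m x y p n : agree n x y -> (p < n)%N ->
  first_one m x p -> first_one m y p.
Proof.
move=> xy pn [mp xp xi]; split => //; first by rewrite -xy.
move=> i /andP[mi ip]; rewrite -xy ?xi ?mi //; exact: ltn_trans pn.
Qed.

Lemma agree_first_one m x y p : zero_from m x -> agree m x y ->
  first_one m y p -> agree p.+1 (set_bit p x) y.
Proof.
move=> xm xy [mp yp yi] i; rewrite ltnS leq_eqVlt /set_bit => /orP[/eqP ->|ip].
  by rewrite eqxx orbT yp.
rewrite (ltn_eqF ip) orbF; have [mi|/xy //] := leqP m i.
by rewrite xm // yi // mi.
Qed.

Lemma first_one_agree_set_bit m x y p : zero_from m x -> (m <= p)%N ->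
  agree p.+1 (set_bit p x) y -> first_one m y p.
Proof.
move=> xm mp xy; split => //; first by rewrite -xy // /set_bit eqxx orbT.
move=> i /andP[mi ip]; rewrite -xy /set_bit ?xm // ?(ltn_eqF ip) //.
exact: leqW.
Qed.

Lemma agree_of_set_bit m x y p : (m <= p)%N -> agree p.+1 (set_bit p x) y ->
  agree m x y.
Proof.
move=> mp xy i im; have ip := leq_trans im mp.
by rewrite -xy ?/set_bit ?(ltn_eqF ip) ?orbF //; exact: leqW.
Qed.

(* A node is a finite word [x] of length [m]. With the flag it stands for the
   continuations whose next nonzero bit, if any, is at an even position: these
   are the small neighbourhoods of the tip of [x], because only an odd position
   makes the height drop. *)
Definition node := (bits * nat * bool)%type.

Definition node_set (v : node) : set bits :=
  let: (x, m, w) := v in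
  [set y | agree m x y /\ (w -> forall p, first_one m y p -> ~~ odd p)].

(** Child [0] collects the continuations whose next one is not at an odd position and rounds the
    length up to an even number. The other children fix that odd position; [m + ~~ odd m] is the
    least odd number not below [m]. *)
Definition split_child x m n : node :=
  if n is n'.+1 then let p := (m + ~~ odd m + n'.*2)%N in (set_bit p x, p.+1, false)
  else (x, m + odd m, true)%N.

(** At a flagged node the length [m] is even. If bit [m] is zero, then bit [m.+1] must be zero too,
    whence the length [m.+2]; if bit [m] is set, the extended word is split like an unflagged
    one. *)
Definition node_child (v : node) n : node :=
  let: (x, m, w) := v in
  if w then
    (if n is n'.+1 then split_child (set_bit m x) m.+1 n' else (x, m.+2, true))
  else split_child x m n.

Definition valid_node (v : node) : Prop :=
  let: (x, m, w) := v in zero_from m x /\ (w -> ~~ odd m).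

(** Raising the flag may leave the length unchanged, so the flag counts as half a step; every child
    is then strictly larger. *)
Definition node_size (v : node) : nat := let: (x, m, w) := v in (m.*2 + w)%N.

Lemma zero_from_le m n x : (m <= n)%N -> zero_from m x -> zero_from n x.
Proof. by move=> mn xm i ni; apply: xm; exact: leq_trans ni. Qed.

Lemma split_child_valid x m n : zero_from m x -> valid_node (split_child x m n).
Proof.
move=> xm; case: n => [|n] /=.
  split; first by apply: zero_from_le xm; exact: leq_addr.
  by rewrite oddD oddb addbb.
by split=> //; apply: set_bit_zero xm _; lia.
Qed.

Lemma split_child_size x m n : (m.*2 < node_size (split_child x m n))%N.
Proof. by case: n => [|n] /=; lia. Qed.

Lemma node_child_valid v n : valid_node v -> valid_node (node_child v n).
Proof.
move: v => [[x m] [|]] /= [xm me]; last exact: split_child_valid.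
case: n => [|n]; last by apply: split_child_valid; exact: set_bit_zero xm _.
split; first by apply: zero_from_le xm; lia.
by move=> _; rewrite /= negbK; exact: me.
Qed.

Lemma node_child_size v n : (node_size v < node_size (node_child v n))%N.
Proof.
move: v => [[x m] [|]] /=; last by have := split_child_size x m n; lia.
case: n => [|n] /=; first lia.
by have := split_child_size (set_bit m x) m.+1 n; lia.
Qed.

Lemma split_child_sub x m n : zero_from m x ->
  node_set (split_child x m n) `<=` [set y | agree m x y].
Proof.
move=> xm; case: n => [|n] y /= [xy _].
  by apply: agree_le xy; exact: leq_addr.
by apply: agree_of_set_bit xy; lia.
Qed.

Lemma split_child_cover x m y : zero_from m x -> agree m x y ->
  exists n, node_set (split_child x m n) y.
Proof.
move=> xm xy; have [[p [fp op]]|nop] := pselect (exists p, first_one m y p /\ odd p).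
  have [mp _ _] := fp.
  have h1 : (m + ~~ odd m <= p)%N.
    move: mp; rewrite leq_eqVlt => /orP[/eqP mp|mp]; last by case: (odd m); lia.
    by rewrite mp op; lia.
  have pE : p = (m + ~~ odd m + (p - (m + ~~ odd m))./2.*2)%N.
    have h2 : ~~ odd (p - (m + ~~ odd m)) by rewrite oddB // oddD op; case: (odd m).
    by have := odd_double_half (p - (m + ~~ odd m)); lia.
  exists (p - (m + ~~ odd m))./2.+1; rewrite /= -pE; split => //.
  exact: agree_first_one fp.
exists 0%N => /=.
have ne p : first_one m y p -> ~~ odd p.
  by move=> fp; apply/negP => op; apply: nop; exists p.
have ym : odd m -> y m = false.
  move=> om; apply/negP => ym; have : ~~ odd m; last by rewrite om.
  by apply: ne; split => // i; lia.
split.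
  case: (boolP (odd m)) => [om|_] /=; last by rewrite addn0.
  by rewrite addn1; apply: agreeS => //; rewrite ym // xm.
move=> _ p [mp yp yi]; apply: ne; split => //; first by lia.
move=> i /andP[mi ip]; have [mi'|im] := leqP (m + odd m) i; first by rewrite yi // mi'.
have -> : i = m by lia.
by apply: ym; move: im mi; case: (odd m); lia.
Qed.

Lemma split_child_disjoint x m k n y : zero_from m x ->
  node_set (split_child x m k) y -> node_set (split_child x m n) y -> k = n.
Proof.
move=> xm.
have h0 n' : node_set (split_child x m 0) y -> ~ node_set (split_child x m n'.+1) y.
  move=> /= [xy ne] [yn _]; set p := (_ + _ + _)%N in yn.
  have op : odd p by rewrite /p !oddD odd_double addbF oddb; case: (odd m).
  have mp : (m <= p)%N by rewrite /p -addnA leq_addr.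
  have [_ yp yi] := first_one_agree_set_bit xm mp yn.
  have [mop|pmo] := leqP (m + odd m) p; last first.
    by move: yp; rewrite -xy // xm.
  suff fp : first_one (m + odd m) y p by have := ne isT p fp; rewrite op.
  by split => // i /andP[mi ip]; apply: yi; lia.
case: k n => [|k] [|n] //; try by [move=> /h0 h /h|move=> h /h0 /(_ h)].
move=> /= [yk _] [yn _].
have mk : (m <= m + ~~ odd m + k.*2)%N by lia.
have mn : (m <= m + ~~ odd m + n.*2)%N by lia.
have := first_one_uniq (first_one_agree_set_bit xm mk yk)
  (first_one_agree_set_bit xm mn yn).
by move=> /addnI/double_inj ->.
Qed.
Lemma node_child_sub v n : valid_node v -> node_set (node_child v n) `<=` node_set v.
Proof.
move: v => [[x m] [|]] /= [xm me] y; last first.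
  by move=> /(split_child_sub xm).
have om := me isT; case: n => [|n].
  move=> [xy ne]; split; first by apply: agree_le xy; lia.
  move=> _ p [mp yp yi]; apply: ne => //; split => //.
    rewrite leqNgt; apply/negP => pm; move: yp; rewrite -xy // xm //.
  by move=> i /andP[mi ip]; apply: yi; lia.
move=> /(split_child_sub (set_bit_zero xm (leqnn m))) /= xy.
split; first exact: agree_of_set_bit xy.
move=> _ p fp; suff <- : m = p by [].
by apply: first_one_uniq fp; apply: first_one_agree_set_bit xy.
Qed.

Lemma node_child_cover v : valid_node v ->
  node_set v `<=` \bigcup_n node_set (node_child v n).
Proof.
move: v => [[x m] [|]] [xm me] y /= [xy ne]; last first.
  by have [n yn] := split_child_cover xm xy; exists n.
have om := me isT; have [ym|ym] := boolP (y m).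
  have xy' : agree m.+1 (set_bit m x) y.
    by apply: (agree_first_one xm xy); split => // i; lia.
  have [n yn] := split_child_cover (set_bit_zero xm (leqnn m)) xy'.
  by exists n.+1.
have ym1 : y m.+1 = false.
  apply/negP => ym1; have : ~~ odd m.+1; last by rewrite /= om.
  apply: ne => //; split => // i /andP[mi im].
  have -> : i = m by lia.
  exact/negbTE.
exists 0%N => //=; split.
  apply: agreeS; last by rewrite ym1 xm.
  by apply: agreeS => //; rewrite xm //; apply/esym/negbTE.
move=> _ p [mp yp yi]; apply: ne => //; split => //; first by lia.
move=> i /andP[mi ip]; have [mi'|im] := leqP m.+2 i; first by rewrite yi // mi'.
have [->|->] : i = m \/ i = m.+1 by lia.
  exact/negbTE.
exact: ym1.
Qed.

Lemma node_child_disjoint v k n y : valid_node v ->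
  node_set (node_child v k) y -> node_set (node_child v n) y -> k = n.
Proof.
move: v => [[x m] [|]] [xm me]; last exact: split_child_disjoint.
have h0 n' : node_set (node_child (x, m, true) 0) y ->
    ~ node_set (node_child (x, m, true) n'.+1) y.
  move=> /= [xy _] /(split_child_sub (set_bit_zero xm (leqnn m))) /= xy'.
  have := xy m; rewrite -xy' // xm // /set_bit eqxx orbT => /(_ _); lia.
case: k n => [|k] [|n] //; try by [move=> /h0 h /h|move=> h /h0 /(_ h)].
by move=> /= hk hn; rewrite (split_child_disjoint (set_bit_zero xm (leqnn m)) hk hn).
Qed.

Let root : node := (fun=> false, 0%N, false).

Lemma node_walk_valid al k : valid_node (walk root node_child al k).
Proof. by elim: k => //= k; exact: node_child_valid. Qed.

Lemma node_walk_size al k : (k <= node_size (walk root node_child al k))%N.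
Proof.
elim: k => //= k IH; exact: leq_ltn_trans IH (node_child_size _ _).
Qed.

Lemma node_walk_sub al k l : (k <= l)%N ->
  node_set (walk root node_child al l) `<=` node_set (walk root node_child al k).
Proof.
move=> /subnK <-; elim: (l - k)%N => //= i IH y yi.
apply: IH; apply: node_child_sub yi; exact: node_walk_valid.
Qed.

Definition center (v : node) : bits := v.1.1.
Definition depth (v : node) : nat := v.1.2.

Lemma node_child_depth v n : (depth v <= depth (node_child v n))%N.
Proof.
have := node_child_size v n; rewrite /depth.
case: (node_child v n) => [[c' m'] w']; case: v => [[c m] w] /=.
by case: w w' => -[] /=; lia.
Qed.

Lemma node_set_agree v y : node_set v y -> agree (depth v) (center v) y.
Proof. by case: v => [[x m] w] []. Qed.

Lemma node_set_center v : valid_node v -> node_set v (center v).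
Proof.
case: v => [[x m] w] [xm _]; split => // _ p [mp].
by rewrite /center /= xm.
Qed.

Lemma depth_unbounded al N : (N <= depth (walk root node_child al N.*2.+1))%N.
Proof.
have := node_walk_size al N.*2.+1.
by case: (walk _ _ _ _) => [[x m] w] /=; rewrite /depth /=; case: w; lia.
Qed.

(** However late the drop occurs, its index stays below [count r (code x m)], so its size is bounded
    below. This is what makes flagged nodes open around the tips of their words. *)
Lemma gentle_drop_gap m x : zero_from m x ->
  exists2 e, 0 < e & forall y p, agree m x y -> first_one m y p -> odd p ->
    e <= f x - f y.
Proof.
move=> xm; exists (d (last_one x m + count r (code x m)).+2).
  exact: d_gt0.
move=> y p xy fp op; have [mp yp _] := fp.
have xyp : agree p x y.
  have := agree_first_one xm xy fp; move=> xyp i ip.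
  by rewrite -xyp ?(leqW ip) // /set_bit (ltn_eqF ip) orbF.
have fx : f x = H x p by exact: (limit_finite _ _ rule (zero_from_le mp xm)).
have := f_le y p.+1; rewrite /H /= yp op /= -/(H _ _) /gentle_drop.
rewrite -(H_agree xyp) -fx -(last_one_agree xyp) -(code_agree xyp).
rewrite (last_one_stable xm mp) (code_stable xm mp) => fy.
have : d (last_one x m + count r (code x m)).+2 <=
    d (last_one x m + (p - last_one x m)./2 %% count r (code x m)).+2.
  by apply: d_le; rewrite !ltnS leq_add2l; apply/ltnW/ltn_pmod.
lra.
Qed.

(** A one at an even position [p] costs no height and raises [last_one] to [p.+1], so all later
    drops together amount to at most [d p.+2]. *)
Lemma gentle_even_near m x y : zero_from m x -> agree m x y ->
  (forall p, first_one m y p -> ~~ odd p) -> `|f x - f y| <= d m.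
Proof.
move=> xm xy ne; have [ym|[p fp]] := first_oneP m y.
  suff -> : x = y by rewrite subrr normr0 ltW ?d_gt0.
  apply/funext => i; have [/xy //|mi] := ltnP i m.
  by rewrite xm ?ym.
have [mp yp _] := fp; have op := ne p fp.
have xyp : agree p x y.
  have := agree_first_one xm xy fp; move=> xyp i ip.
  by rewrite -xyp ?(leqW ip) // /set_bit (ltn_eqF ip) orbF.
have fx : f x = H x p by exact: (limit_finite _ _ rule (zero_from_le mp xm)).
have := f_le y p.+1; have := f_ge y p.+1.
rewrite /H /= yp (negbTE op) /= -/(H _ _) -(H_agree xyp) -fx => h1 h2.
have : d p.+2 <= d m by apply: d_le; lia.
by rewrite ler_norml; lra.
Qed.

Lemma gentle_agree_near n x y : agree n x y -> `|f x - f y| < d (last_one x n).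
Proof.
move=> xy; have := f_le x n; have := f_ge x n; have := f_le y n; have := f_ge y n.
rewrite -(H_agree xy) -(last_one_agree xy) dS.
by have := d_gt0 R (last_one x n); rewrite ltr_norml; lra.
Qed.

Lemma gentle_scheme : scheme root node_child
  (fun v => [set e : set_type (endpoints R (fan f)) |
    exists2 x, node_set v x & set_val e = leg f x (f x)]).
Proof.
apply: (tip_scheme gentle_marked) => //.
- exact: gentle_gt0.
- by apply/seteqP; split.
- move=> al k v; have vv : valid_node v := node_walk_valid al k; split.
  + move=> x vx; have [n [e [e0 He]]] : exists n e, 0 < e /\
        forall y, agree n x y -> `|f x - f y| < e -> node_set v y.
      move: v vv vx => [[c m] w] [cm mw] [cx cw].
      (* If [x] has no further one, the height gap forbids [y] a first one at an odd position;
         otherwise agreement beyond the first one of [x] gives [y] the same one. *)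
      have [xm|[p fp]] := first_oneP m x.
        have [e e0 He] := gentle_drop_gap xm.
        exists m, e; split => // y xy fxy; split; first exact: agree_trans xy.
        move=> _ p fp; apply/negP => op; have := He y p xy fp op.
        by move: fxy; rewrite ltr_norml; lra.
      have [mp _ _] := fp; exists p.+1, 1; split => // y xy _; split.
        by apply: agree_trans cx _; apply: agree_le xy; exact: leqW.
      move=> wt q fq; rewrite -(first_one_uniq (first_one_agree xy (ltnSn p) fp) fq).
      exact: cw.
    by exists n, e.
  + exact: node_child_cover.
  + by move=> n; exact: node_child_sub.
  + by move=> i j y; exact: node_child_disjoint.
- move=> al x n e e0 xal.
  have agr k y : node_set (walk root node_child al k) y ->
      agree (depth (walk root node_child al k)) x y.
    move=> /node_set_agree cy; apply: agree_trans cy.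
    by apply/agree_sym/node_set_agree/xal.
  have [N dN] := d_small e0.
  (* With infinitely many ones agreement alone controls the height, since [last_one] grows; a finite
     sequence needs a flagged node. *)
  have [[n0 xn0]|nx] := pselect (finite_bits x); last first.
    have [m Nm] := last_one_unbounded N nx.
    exists (maxn m n).*2.+1 => y /agr xy.
    have {}xy := agree_le (depth_unbounded al (maxn m n)) xy.
    split; first by apply: agree_le xy; exact: leq_maxr.
    apply: lt_trans dN; apply: lt_le_trans (gentle_agree_near xy) _.
    apply: d_le; apply: leq_trans (ltnW Nm) _; apply: last_one_mono.
    exact: leq_maxl.
  (* Beyond the last one of [x], an unflagged node can only be followed by its flagged child,
     because the other children set a bit. *)
  have [k [kd wk]] : exists k, (maxn N (maxn n n0) <= depth (walk root node_child al k))%N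
      /\ (walk root node_child al k).2.
    have := depth_unbounded al (maxn N (maxn n n0)).
    move: (_.*2.+1) => k0 kd.
    have := xal k0.+1; have := xal k0; have := node_walk_valid al k0.
    rewrite [walk _ _ _ k0.+1]/= -/(walk _ _ _ k0).
    case E : (walk root node_child al k0) kd => [[c m] [|]] kd [cm _] [cx _] xk.
      by exists k0; rewrite E.
    exists k0.+1; rewrite [walk _ _ _ k0.+1]/= -/(walk _ _ _ k0) E /=.
    case: (al k0) xk => [|i] /=; first by split => //; apply: leq_trans kd (leq_addr _ _).
    move=> [cx' _]; exfalso; set p := (_ + _ + _)%N in cx'.
    have mp : (m <= p)%N by rewrite /p; lia.
    have [_ xp _] := first_one_agree_set_bit cm mp cx'.
    move: xp; rewrite xn0 //; apply: leq_trans mp; apply: leq_trans kd.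
    by rewrite !leq_max leqnn !orbT.
  exists k => y yk; have xy := agr k y yk.
  have xm : zero_from (depth (walk root node_child al k)) x.
    by apply: zero_from_le xn0; apply: leq_trans kd; rewrite !leq_max leqnn !orbT.
  split.
    by apply: agree_le xy; apply: leq_trans kd; rewrite !leq_max leqnn !orbT.
  apply: le_lt_trans dN; apply: le_trans (gentle_even_near xm xy _) _; last first.
    by apply: d_le; apply: leq_trans kd; rewrite !leq_max leqnn.
  by move: yk wk; case: (walk _ _ _ _) => [[c m] w] /= [_ h] /h.
- move=> al.
  pose v k := walk root node_child al k.
  (* Bit [i] is read at a stage whose depth exceeds [i], after which it no longer changes. *)
  pose x : bits := fun i => center (v i.+1.*2.+1) i.
  have nest k l : (k <= l)%N -> agree (depth (v k)) (center (v k)) (center (v l)).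
    move=> kl; apply: node_set_agree; apply: (node_walk_sub kl).
    exact/node_set_center/node_walk_valid.
  have xv k : agree (depth (v k)) (center (v k)) x.
    move=> i ik; have [kl|lk] := leqP k i.+1.*2.+1; first exact: (nest _ _ kl).
    apply/esym; apply: (nest _ _ (ltnW lk)); exact: (depth_unbounded al i.+1).
  exists x => k; have vk := node_walk_valid al k.
  have ne p : (v k).2 -> first_one (depth (v k)) x p -> ~~ odd p.
    (* At stage [l] the center agrees with [x] beyond [p], so [p] is also the first one of a member
       of the piece at stage [k]. *)
    move=> w fp; pose l := maxn k p.+1.*2.+1.
    have pl : (p < depth (v l))%N.
      apply: leq_trans (depth_unbounded al p.+1) _.
      have dm i j : (i <= j)%N -> (depth (v i) <= depth (v j))%N.
        move=> /subnK <-; elim: (j - i)%N => //= s; rewrite addSn => IH.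
        by apply: leq_trans IH _; exact: node_child_depth.
      exact: (dm p.+1.*2.+1 l (leq_maxr _ _)).
    have := node_walk_sub (leq_maxl k p.+1.*2.+1) (node_set_center (node_walk_valid al l)).
    have fp' := first_one_agree (agree_sym (xv l)) pl fp.
    rewrite -/(v k); move: w fp'; case: (v k) => [[c m] w'] /= w fp' [_ h].
    exact: h.
  have := xv k; move: ne; rewrite /v.
  by case: (walk _ _ _ _) => [[c m] w] /= ne xc; split => // w1 p; exact: ne.
Qed.

End GentleDrops.

Theorem corollary8 (R : realType) :
  (exists F : R -> metricType R, rigid_fan_family F) /\
  (exists F : R -> metricType R, rigid_fan_family F /\
     forall i, homeomorphic (set_type (endpoints R (F i))) nat) /\
  (exists F : R -> metricType R, rigid_fan_family F /\
     forall i, homeomorphic (set_type (endpoints R (F i)))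
                            (set_type (@irrational R))) /\
  (exists F : R -> metricType R, rigid_fan_family F /\
     forall i, homeomorphic (set_type (endpoints R (F i)))
                            (cantor_space * nat)%type).
Proof.
have nat_rigid : rigid_fan_family
    (fun r => fan (shrinking_height xpredT r) : metricType R).
  by apply: rigid_family => r; apply: shrinking_marked.
split; last split; last split.
- by eexists; exact: nat_rigid.
- by eexists; split; [exact: nat_rigid|exact: nat_endpoints].
- exists (fun r => fan (gentle_height r) : metricType R); split.
    by apply: rigid_family => r; exact: gentle_marked.
  move=> r; apply: (scheme_homeomorphic _ _ (gentle_scheme r) (irrational_scheme R)).
    by apply: hausdorff_set_type; exact: fan_hausdorff.
  by apply: hausdorff_set_type; exact: Rhausdorff.
- exists (fun r => fan (shrinking_height odd r) : metricType R); split.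
    by apply: rigid_family => r; apply: shrinking_marked => p; rewrite /= orbN.
  exact: cantor_nat_endpoints.
Qed.
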